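(* Let $n\ge1$, let $\lambda,\mu$ be partitions with at most $n$ parts with $\mu\subseteq\lambda$, and let $r,s\in\mathbb Z_{>0}^n$ be such that for each $1\le i\le n-1$ with $\mu_i<\lambda_{i+1}$ we have $r_i-\mu_i\le r_{i+1}-\mu_{i+1}$ and $s_i-\lambda_i\le s_{i+1}-\lambda_{i+1}+1$. Then \[ G^{\mathrm{col}(r,s)}_{\lambda'/\mu'}(x;\alpha,\beta)=D\det\Big(e_{\lambda_i-\mu_j-i+j}\big[X_{[r_j,s_i]}\ominus(A_{i-1}-A_j-B_{\lambda_i}+B_{\mu_j})\big]\Big)_{i,j=1}^n, \] where $D=\prod_{i=1}^n\prod_{l=r_i}^{s_i}(1-\alpha_ix_l)^{-1}$ (an empty product is $1$).
   Context: Indeterminates $x=(x_1,x_2,\dots)$, $\alpha=(\alpha_1,\dots)$, $\beta=(\beta_1,\dots)$. For $m\in\mathbb Z$, $A_m=\alpha_1+\dots+\alpha_m$, $B_m=\beta_1+\dots+\beta_m$, with $A_m=B_m=0$ for $m\le0$; $X_{[r,s]}=x_r+\dots+x_s$, which is $0$ if $r>s$. For a formal $\mathbb Z$-linear combination $Z=\sum_vc_vv$ of finitely many indeterminates, $e_m[Z]$ is the coefficient of $t^m$ in $\prod_v(1+vt)^{c_v}$ (so $e_m[Z]=0$ for $m<0$). For such $Y,Z$, $e_m[Y\ominus Z]=\sum_{b\ge0}e_{m+b}[Y]e_b[Z]$. Partitions with at most $n$ parts are padded with zeros. $\lambda'/\mu'$ is the skew shape of cells $(i,j)$ (row $i$,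 column $j$) with $1\le j\le n$ and $\mu_j<i\le\lambda_j$. A marked multiset-valued tableau of shape $\lambda'/\mu'$ is a filling $T$ of these cells such that each $T(i,j)$ is a nonempty finite multiset $\{a_1\le\dots\le a_k\}$ of positive integers in which each $a_t$ with $t\ge2$ and $a_{t-1}<a_t$ may be marked; $\max T(i,j)\le\min T(i,j+1)$ and $\max T(i,j)<\min T(i+1,j)$ whenever the respective cells both lie in the shape. Its weight is $\mathrm{wt}(T)=\prod_{(i,j)}x^{T(i,j)}\alpha_j^{u(i,j)-1}(-\beta_i)^{m(i,j)}$, where $x^{T(i,j)}=\prod_kx_k^{(\text{number of occurrences of }k\text{ in }T(i,j))}$ and $u(i,j),m(i,j)$ are the numbers of unmarked and marked elements of $T(i,j)$. $G^{\mathrm{col}(r,s)}_{\lambda'/\mu'}(x;\alpha,\beta)$ is the sum of $\mathrm{wt}(T)$ over all such $T$ with $r_j\le\min T(i,j)$ and $\max T(i,j)\le s_j$ for all cells $(i,j)$. *)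

(* Defs.v *)
From HB Require Import structures.
From mathcomp Require Import all_boot all_order all_algebra.
From mathcomp Require Import finmap multiset freeg.
From mathcomp Require Import boolp classical_sets functions cardinality fsbigop.

Set Implicit Arguments.
Unset Strict Implicit.
Unset Printing Implicit Defensive.

Import GRing.Theory.

Local Open Scope mset_scope.
Local Open Scope ring_scope.

Section SubMultisets.
Variable V : choiceType.
Implicit Types (A B C : {mset V}).

Definition msubs A : {fset {mset V}} :=
  [fset seq_mset (mask (val b) (enum_mset A)) | b : (size A).-tuple bool]%fset.

Lemma in_msubs A B : (B \in msubs A) = (B `<=` A)%mset.
Proof.
apply/imfsetP/msubsetP => /= [[b _ ->] a|leBA].
  rewrite mset_seqE -count_mem_mset.
  by apply: leq_count_subseq; apply/subseqP; exists b => //; rewrite size_tuple.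
have /count_subseqP[s /subseqP[b szb ->] perm_s]:
    forall a, (count_mem a (enum_mset B) <= count_mem a (enum_mset A))%N.
  by move=> a; rewrite !count_mem_mset.
have szb' : size b == size A by rewrite szb.
exists (Tuple szb') => //=.
by rewrite -[LHS]seq_mset_id; apply/eq_seq_msetP.
Qed.

Lemma perm_msubs_compl A :
  perm_eq (msubs A) [seq msetB A B | B <- msubs A].
Proof.
have injB : {in msubs A &, injective (msetB A)}.
  move=> B C; rewrite !in_msubs => sBA sCA eqBC.
  by rewrite -(msetBBK sBA) eqBC msetBBK.
apply: uniq_perm; rewrite ?map_inj_in_uniq ?fset_uniq // => C.
apply/idP/mapP => [|[B _ ->]]; last by rewrite in_msubs msubsetDl.
rewrite in_msubs => sCA; exists (msetB A C); last by rewrite msetBBK.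
by rewrite in_msubs msubsetDl.
Qed.

Lemma perm_msubs_above A B : (B `<=` A)%mset ->
  perm_eq [seq C <- msubs A | msubset B C]
          [seq msetD B C | C <- msubs (msetB A B)].
Proof.
move=> sBA; apply: uniq_perm.
- by rewrite filter_uniq ?fset_uniq.
- by rewrite map_inj_uniq ?fset_uniq //; apply: can_inj (msetDKB B).
move=> C; rewrite mem_filter in_msubs.
apply/andP/mapP => [[sBC sCA]|[E]].
  exists (msetB C B); last by rewrite msetBDKC.
  by rewrite in_msubs msetSB.
rewrite in_msubs => sE ->; split.
  by apply/msubsetP => a; rewrite msetE2 leq_addr.
by rewrite -(msetBDKC sBA) msetDS.
Qed.

End SubMultisets.

(* R[[V]] for a possibly infinite set V of indeterminates: the monomials are the
   finite multisets over V. *)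
Definition series (R : Type) (V : choiceType) := {mset V} -> R.

Section Series.
Variables (R : comNzRingType) (V : choiceType).
Implicit Types (f g h : series R V) (m : {mset V}).

HB.instance Definition _ := GRing.Zmodule.copy (series R V) ({mset V} -> R).

Definition series_one : series R V := fun m => (m == mset0)%:R.

Definition series_mul f g : series R V :=
  fun m => \sum_(a <- msubs m) f a * g (msetB m a).

Fact series_mulC : commutative series_mul.
Proof.
move=> f g; apply/funext => m; rewrite /series_mul.
rewrite (perm_big _ (perm_msubs_compl m)) big_map.
apply: eq_big_seq => a; rewrite in_msubs => sam.
by rewrite msetBBK // mulrC.
Qed.

Fact series_mulA : associative series_mul.
Proof.
move=> f g h; apply/funext => m; rewrite /series_mul; symmetry.
transitivity (\sum_(c <- msubs m) \sum_(a <- msubs m | msubset a c)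
    f a * g (msetB c a) * h (msetB m c)).
  apply: eq_big_seq => c; rewrite in_msubs => scm.
  rewrite mulr_suml -[RHS]big_filter; apply: perm_big.
  apply: uniq_perm; rewrite ?filter_uniq ?fset_uniq // => a.
  rewrite mem_filter !in_msubs; apply/idP/andP => [sac|[]//].
  by split=> //; apply: msubset_trans scm.
rewrite (exchange_big_dep xpredT) //=.
apply: eq_big_seq => a; rewrite in_msubs => sam.
rewrite -big_filter (perm_big _ (perm_msubs_above sam)) big_map mulr_sumr.
apply: eq_big_seq => b _.
by rewrite msetDKB msetBDA mulrA.
Qed.

Fact series_mul1 : left_id series_one series_mul.
Proof.
move=> f; apply/funext => m; rewrite /series_mul.
rewrite (bigD1_seq mset0) ?fset_uniq ?in_msubs ?msub0set //=.
rewrite /series_one eqxx mul1r msetB0 big1 ?addr0 // => a /negbTE->.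
by rewrite mul0r.
Qed.

Fact series_mulDl : left_distributive series_mul +%R.
Proof.
move=> f g h; apply/funext => m.
rewrite -[RHS]/(series_mul f h m + series_mul g h m) /series_mul -big_split /=.
by apply: eq_bigr => a _; rewrite mulrDl.
Qed.

Fact series_one_neq0 : series_one != 0.
Proof.
apply/eqP => /(congr1 (fun f : series R V => f mset0)).
by rewrite /series_one eqxx; apply/eqP/oner_neq0.
Qed.

HB.instance Definition _ := GRing.Zmodule_isComNzRing.Build (series R V)
  series_mulA series_mulC series_mul1 series_mulDl series_one_neq0.

(* The units are all the invertible series, so that f^-1 is the inverse of f
   whenever it exists. *)
Definition series_unit f : bool := `[< exists g, g * f = 1 >].

Definition series_inv f : series R V :=
  if pselect (exists g, g * f = 1) is left fU then projT1 (cid fU) else f.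

Fact series_mulVr : {in [pred f | series_unit f], left_inverse 1 series_inv *%R}.
Proof.
move=> f; rewrite inE => /asboolP/asboolP fU; rewrite /series_inv.
by case: pselect => [fU'|/(_ fU)//]; apply: (projT2 (cid fU')).
Qed.

Fact series_unitP f g : g * f = 1 -> series_unit f.
Proof. by move=> fg; apply/asboolP; exists g. Qed.

Fact series_inv_out : {in [predC [pred f | series_unit f]], series_inv =1 id}.
Proof.
move=> f; rewrite !inE => /asboolPn fU; rewrite /series_inv.
by case: pselect.
Qed.

HB.instance Definition _ := GRing.ComNzRing_hasMulInverse.Build (series R V)
  series_mulVr series_unitP series_inv_out.

Definition indet (v : V) : series R V := fun m => (m == [mset v]%mset)%:R.

Definition constant (c : R) : series R V := fun m => if m == mset0 then c else 0.

(* The sum is taken coefficient by coefficient; it is meaningful when, for each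
   monomial, only finitely many terms contribute (otherwise [fsbigop] returns 0
   for the coefficient). *)
Definition infsum (I : choiceType) (A : set I) (F : I -> series R V) :
    series R V :=
  fun m => \sum_(i \in A) F i m.

End Series.

Arguments constant {R V} c.
Arguments indet {R V} v.

(* The indices in use start from 1; the index 0 never occurs. *)
Inductive var := Vx of nat | Valpha of nat | Vbeta of nat.

Definition var_code (v : var) : nat + (nat + nat) :=
  match v with
  | Vx k => inl k
  | Valpha k => inr (inl k)
  | Vbeta k => inr (inr k)
  end.

Definition var_decode (c : nat + (nat + nat)) : var :=
  match c with
  | inl k => Vx k
  | inr (inl k) => Valpha k
  | inr (inr k) => Vbeta k
  end.

Fact var_codeK : cancel var_code var_decode.
Proof. by case. Qed.

HB.instance Definition _ := Countable.copy var (can_type var_codeK).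

Notation pseries := (series int var).

Definition x_ (k : nat) : pseries := indet (Vx k).
Definition alpha_ (k : nat) : pseries := indet (Valpha k).
Definition beta_ (k : nat) : pseries := indet (Vbeta k).

Notation lincomb := {freeg var / int}.

Definition A_ (m : nat) : lincomb := \sum_(1 <= k < m.+1) << Valpha k >>.
Definition B_ (m : nat) : lincomb := \sum_(1 <= k < m.+1) << Vbeta k >>.
Definition X_ (a b : nat) : lincomb := \sum_(a <= k < b.+1) << Vx k >>.

(* \prod_v (1 + v t)^(c_v) in Z[[x, alpha, beta]][[t]]; the monomials in the
   single indeterminate t are the multisets over [unit]. *)
Definition egen (Z : lincomb) : series pseries unit :=
  \prod_(v <- dom Z)
    (1 + constant (indet v) * indet tt) ^ coeff v Z.

Definition e (m : int) (Z : lincomb) : pseries :=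
  if m is Posz k then egen Z (msetn k tt) else 0.

Definition e_ominus (m : int) (Y Z : lincomb) : pseries :=
  infsum [set: nat] (fun b : nat => e (m + b%:Z) Y * e b%:Z Z).

(* A partition with at most n parts, padded with zeros. Here, as everywhere
   below, the element i of 'I_n stands for the index i + 1 in 1, ..., n. *)
Definition is_partition (n : nat) (lam : 'I_n -> nat) : bool :=
  [forall i : 'I_n, forall j : 'I_n, (i <= j)%N ==> (lam j <= lam i)%N].

(* A multiset is listed in weakly increasing order a_1 <= ... <= a_k, each
   element being paired with a boolean telling whether it is marked. *)
Definition mmset := seq (nat * bool).

Definition is_mmset (S : mmset) : bool :=
  [&& S != [::],
      all (fun a => 0 < a)%N (unzip1 S),
      sorted leq (unzip1 S)
    & [forall t : 'I_(size S),
        nth false (unzip2 S) t ==>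
          (0 < t)%N && (nth 0%N (unzip1 S) t.-1 < nth 0%N (unzip1 S) t)%N]].

Definition mmin (S : mmset) : nat := head 0%N (unzip1 S).
Definition mmax (S : mmset) : nat := last 0%N (unzip1 S).

Definition unmarked (S : mmset) : nat := count (fun a => ~~ a.2) S.
Definition marked (S : mmset) : nat := count (fun a => a.2) S.

Section Tableaux.
Variables (n : nat) (lam mu : 'I_n -> nat).

(* The cells of lam'/mu': the pair of j : 'I_n and i : 'I_(lam j) stands for
   the cell in row i + 1 and column j + 1. *)
Definition cell : finType :=
  {c : {j : 'I_n & 'I_(lam j)} | (mu (tag c) <= tagged c)%N}.

Definition colidx (c : cell) : 'I_n := tag (val c).
Definition row (c : cell) : nat := (tagged (val c)).+1.
Definition col (c : cell) : nat := (colidx c).+1.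

Definition filling := {ffun cell -> mmset}.

Definition is_tableau (T : filling) : bool :=
  [&& [forall c, is_mmset (T c)],
      [forall c, forall d, (row d == row c) && (col d == (col c).+1) ==>
         (mmax (T c) <= mmin (T d))%N]
    & [forall c, forall d, (row d == (row c).+1) && (col d == col c) ==>
         (mmax (T c) < mmin (T d))%N]].

Definition col_flagged (r s : 'I_n -> nat) (T : filling) : bool :=
  [forall c, (r (colidx c) <= mmin (T c))%N && (mmax (T c) <= s (colidx c))%N].

Definition wt (T : filling) : pseries :=
  \prod_(c : cell) ((\prod_(a <- T c) x_ a.1)
    * alpha_ (col c) ^+ (unmarked (T c)).-1 * (- beta_ (row c)) ^+ marked (T c)).

Definition Gcol (r s : 'I_n -> nat) : pseries :=
  infsum [set T : filling | is_tableau T && col_flagged r s T] wt.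

End Tableaux.

(* Main.v *)
Require Import Defs.
From mathcomp Require Import all_boot all_order all_algebra.
From mathcomp Require Import finmap multiset freeg.
From mathcomp Require Import boolp classical_sets functions cardinality fsbigop.
From mathcomp Require Import perm zify ring.

(* Proof idea.  Put [c_i = s_i - lam_i] and induct on [s_1 + ... + s_n], showing
   that both sides obey the same recurrences.  If some column has more cells
   than available values, there is no tableau and the matrix has a zero block
   that kills its determinant.  If the shape is empty, the matrix is triangular
   with diagonal entries the inverses of the factors of [D].  Otherwise let [i]
   be the last nonempty column for which [c_i] is maximal, and write
   [x = x_(s_i)].
   - If [lam_(i+1) < lam_i], split the tableaux according to the last element of
     the bottom cell of column [i]: it is smaller than [s_i], or it is [s_i] and
     can be deleted (together with the cell if it was alone in it).  This gives
       (1 - alpha_i x) G(lam, s)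
         = (1 - beta_(lam_i) x) G(lam, s - e_i) + x G(lam - e_i, s - e_i),
     and row [i] of the matrix satisfies the same relation up to the factor
     coming from [D].
   - If [lam_(i+1) = lam_i], the flag condition and the choice of [i] force
     [s_i = s_(i+1) + 1]; column [i+1] then prevents column [i] from using
     [s_i], and row [i] of the matrix is [1 - alpha_i x] times the row
     for [s - e_i], plus [x] times row [i+1].
   Both relations between rows only use
     e_m[(Y + x) (-) Z] = e_m[Y (-) Z] + x e_(m-1)[Y (-) Z],
     e_m[Y (-) (Z + v)] = e_m[Y (-) Z] + v e_(m+1)[Y (-) Z]. *)

Set Implicit Arguments.
Unset Strict Implicit.
Unset Printing Implicit Defensive.

Import Order.TTheory GRing.Theory Num.Theory.
Local Open Scope mset_scope.
Local Open Scope ring_scope.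

(** * Formal power series *)

Section SeriesTheory.
Variables (R : comNzRingType) (V : choiceType).
Implicit Types (c : R) (f g h : series R V) (m : {mset V}).

Lemma series_mulE f g m :
  (f * g) m = \sum_(a <- msubs m) f a * g (msetB m a).
Proof. by []. Qed.

Lemma series_addE f g m : (f + g) m = f m + g m.
Proof. by []. Qed.

Lemma series_oppE f m : (- f) m = - f m.
Proof. by []. Qed.

Lemma series_sumE (I : Type) (s : seq I) (P : pred I) (F : I -> series R V) m :
  (\sum_(i <- s | P i) F i) m = \sum_(i <- s | P i) F i m.
Proof. by apply: (big_morph (fun f => f m)). Qed.

Lemma series_oneE m : (1 : series R V) m = (m == mset0)%:R.
Proof. by []. Qed.

Lemma msubs0 : msubs (mset0 : {mset V}) = [fset mset0]%fset.
Proof. by apply/fsetP => a; rewrite in_msubs inE msubset0. Qed.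

Lemma series_mul_mset0 f g : (f * g) mset0 = f mset0 * g mset0.
Proof. by rewrite series_mulE msubs0 big_seq_fset1 msetB0. Qed.

Lemma constant_mulE c f m : (Defs.constant c * f) m = c * f m.
Proof.
rewrite series_mulE (bigD1_seq mset0) ?fset_uniq ?in_msubs ?msub0set //=.
rewrite /Defs.constant eqxx msetB0 big1 ?addr0 // => a /negbTE ->.
by rewrite mul0r.
Qed.

Lemma indet_mulE v f m :
  (indet v * f) m = if v \in m then f (msetB m [mset v]%mset) else 0.
Proof.
rewrite series_mulE; case: ifPn => [vm|vNm].
  rewrite (bigD1_seq [mset v]%mset) ?fset_uniq ?in_msubs ?msub1set //=.
  rewrite /indet eqxx mul1r big1 ?addr0 // => a /negbTE ->.
  by rewrite mul0r.
rewrite big1_seq // => a /andP[_]; rewrite in_msubs => sam.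
rewrite /indet; case: eqP => [ea|]; last by rewrite mul0r.
by move: sam; rewrite ea msub1set (negbTE vNm).
Qed.

Lemma size_msetB (a m : {mset V}) : (a `<=` m)%mset ->
  (size (msetB m a) + size a = size m)%N.
Proof.
move=> sam; rewrite -[in RHS](msetBDK sam) -size_cat; apply/esym/perm_size.
by apply/allP => x _; rewrite /= count_cat !count_mem_mset msetE2.
Qed.

Lemma series_exp_small f k m : f mset0 = 0 -> (size m < k)%N -> (f ^+ k) m = 0.
Proof.
move=> f0; elim: k m => [//|k IH] m szm.
rewrite exprS series_mulE big1_seq // => a /andP[_]; rewrite in_msubs => sam.
have [->|aN0] := eqVneq a mset0; first by rewrite f0 mul0r.
rewrite IH ?mulr0 //; move: szm (size_msetB sam) aN0.
by rewrite -size_mset_eq0; lia.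
Qed.

(** The inverse is the geometric series in [h = 1 - f]. Since [h] has no constant term, [h ^+ k]
    only has monomials of size at least [k], so each coefficient can be read off a truncation. *)
Lemma series_unit1 f : f mset0 = 1 -> f \is a GRing.unit.
Proof.
move=> f1; pose h := 1 - f.
have h0 : h mset0 = 0.
  by rewrite /h series_addE series_oppE series_oneE eqxx f1 subrr.
pose g : series R V := fun m => (\sum_(k < (size m).+1) h ^+ k) m.
have gE N m : (size m < N)%N -> g m = (\sum_(k < N) h ^+ k) m.
  move=> szm; rewrite /g !series_sumE -!(big_mkord xpredT (fun k => (h ^+ k) m)).
  rewrite [RHS](big_cat_nat (n := (size m).+1)) //=.
  rewrite [X in _ = _ + X]big_nat_cond [X in _ = _ + X]big1 ?addr0 //.
  by move=> k /andP[/andP[szk _] _]; apply: series_exp_small.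
suff gf : f * g = 1 by apply/unitrPr; exists g.
rewrite mulrC; apply/funext => m; rewrite series_mulE.
have -> : \sum_(a <- msubs m) g a * f (msetB m a) =
          ((\sum_(k < (size m).+1) h ^+ k) * f) m.
  rewrite series_mulE; apply: eq_big_seq => a; rewrite in_msubs => sam.
  by rewrite (gE (size m).+1) // ltnS -(size_msetB sam) leq_addl.
have -> : f = - (h - 1) by rewrite /h opprB opprB addrC subrK.
rewrite mulrN mulrC -subrX1 opprB series_addE series_oppE.
by rewrite (series_exp_small h0) ?subr0.
Qed.

End SeriesTheory.

(** * Generating functions of elementary symmetric functions *)

Section EGen.
Implicit Types (Z W : lincomb) (v : var) (k : nat) (m : int).

Let lin v : series pseries unit := 1 + Defs.constant (indet v) * indet tt.

(** Coefficients of a [lincomb] may be negative; exponents then add up because the linear factors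
    are invertible. *)
Lemma lin_unit v : lin v \is a GRing.unit.
Proof.
apply: series_unit1; rewrite /lin series_addE series_oneE eqxx constant_mulE.
rewrite /indet (_ : (_ == _) = false) ?mulr0 ?addr0 //.
by apply/mset_eqP => /(_ tt); rewrite !(mset0E, msetnE).
Qed.

Lemma egen_super Z (s : seq var) : uniq s -> {subset dom Z <= s} ->
  egen Z = \prod_(v <- s) lin v ^ coeff v Z.
Proof.
move=> us sZ; rewrite [RHS](bigID (mem (dom Z))) /= [X in _ * X]big1 ?mulr1.
  rewrite -[RHS]big_filter; apply: perm_big; apply: uniq_perm.
  - exact: uniq_dom.
  - exact: filter_uniq.
  - by move=> v; rewrite mem_filter; case: (boolP (v \in dom Z)) => //= /sZ ->.
by move=> v /coeff_outdom ->; rewrite expr0z.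
Qed.

Lemma egenD Z W : egen (Z + W) = egen Z * egen W.
Proof.
pose s := undup (dom (Z + W) ++ dom Z ++ dom W).
rewrite !(@egen_super _ s) ?undup_uniq // => [|v|v|v];
  rewrite ?mem_undup ?mem_cat; try by move=> ->; rewrite ?orbT.
rewrite -big_split /=; apply: eq_bigr => v _.
by rewrite coeffD exprzDr // lin_unit.
Qed.

Lemma egen0 : egen 0 = 1.
Proof.
rewrite (@egen_super 0 [::]) ?big_nil // => v.
by rewrite mem_dom coeff0 eqxx.
Qed.

Lemma egenU v : egen << v >> = lin v.
Proof.
rewrite (@egen_super _ [:: v]) // => [|w].
  by rewrite big_seq1 coeffU eqxx mulr1 expr1z.
by rewrite mem_dom coeffU mul1r mem_seq1 [w == v]eq_sym; case: (v == w).
Qed.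

Lemma eDU m Z v : e m (Z + << v >>) = e m Z + indet v * e (m - 1) Z.
Proof.
case: m => [k|k]; last first.
  by rewrite (_ : Negz k - 1 = Negz k.+1) /= ?mulr0 ?addr0 //; lia.
have eE : e k (Z + << v >>) = e k Z + indet v *
    (if tt \in msetn k tt then egen Z (msetB (msetn k tt) [mset tt]%mset) else 0).
  rewrite /e egenD egenU /lin mulrDr mulr1 series_addE; congr (_ + _).
  by rewrite mulrC -mulrA constant_mulE indet_mulE.
rewrite {}eE; congr (_ + _ * _); rewrite in_msetn; case: k => [//|k].
rewrite (_ : k.+1%:Z - 1 = k); last by lia.
rewrite /=.
by congr (egen Z _); apply/msetP => -[]; rewrite !(mset0E, msetnE, msetE2) /= subn1.
Qed.

Lemma e0 m : e m 0 = (m == 0)%:R.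
Proof.
case: m => [k|k] //=; rewrite egen0 series_oneE; congr (_%:R); congr nat_of_bool.
by apply/eqP/eqP => [/msetP/(_ tt)|[->]]; rewrite ?msetn0 // msetnxx mset0E => ->.
Qed.

(** The generating function of a plain sum is a polynomial whose degree is at most the number of
    summands. *)
Lemma e_sum_gt (s : seq var) m : (size s)%:Z < m ->
  e m (\sum_(v <- s) << v >>) = 0.
Proof.
elim: s m => [|v s IH] m /=; first by rewrite big_nil e0; case: eqP => // ->.
by move=> ltm; rewrite big_cons addrC eDU !IH ?mulr0 ?addr0 //; lia.
Qed.

End EGen.

(** * Recurrences for [e_ominus] *)

Section EOminus.
Implicit Types (Z : lincomb) (v : var) (a b : nat) (m : int).

Lemma X_geq a b : (b < a)%N -> X_ a b = 0.
Proof. by move=> lt_ba; rewrite /X_ big_geq. Qed.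

Lemma X_recr a b : (a <= b.+1)%N -> X_ a b.+1 = X_ a b + << Vx b.+1 >>.
Proof. by move=> le_ab; rewrite /X_ big_nat_recr. Qed.

Lemma e_X_gt a b m : (b.+1 - a)%N%:Z < m -> e m (X_ a b) = 0.
Proof.
move=> ltm; rewrite /X_ -(big_map Vx xpredT (fun v => << v >>)).
by apply: e_sum_gt; rewrite size_map size_iota.
Qed.

(** [X_ a b] has [b.+1 - a] variables, so all terms from [K] on vanish. The bound [K] is left free
    so that several such sums can be cut at matching lengths. *)
Lemma e_ominusE K a b m Z : (b.+1 - a)%N%:Z < m + K%:Z ->
  e_ominus m (X_ a b) Z = \sum_(k < K) e (m + k%:Z) (X_ a b) * e k Z.
Proof.
move=> ltK; apply/funext => M; rewrite series_sumE /e_ominus /infsum.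
rewrite (fsbig_ord _ _ (fun k : nat => (e (m + k%:Z) (X_ a b) * e k Z) M)).
apply/esym/fsbig_widen => // k [_ /negP]; rewrite /= -leqNgt => leKk.
by rewrite e_X_gt ?mul0r //; lia.
Qed.

Lemma e_ominus_gt a b m Z : (b.+1 - a)%N%:Z < m -> e_ominus m (X_ a b) Z = 0.
Proof. by move=> ltm; rewrite (@e_ominusE 0) ?big_ord0 // addr0. Qed.

(** A nonzero [k]-th term needs both [m + k >= 0] and [k <= size s], which are incompatible here. *)
Lemma e_ominus_sum_lt a b m (s : seq var) : m + (size s)%:Z < 0 ->
  e_ominus m (X_ a b) (\sum_(v <- s) << v >>) = 0.
Proof.
move=> ltm; rewrite (@e_ominusE ((b.+1 - a) + `|m|).+1); last by lia.
apply: big1 => k _; have [ltk|lek] := ltP (m + k%:Z) 0.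
  by case: (m + k%:Z) ltk => // j _; rewrite mul0r.
by rewrite e_sum_gt ?mulr0 //; lia.
Qed.

Lemma e_ominus_Xrecr a b m Z : (a <= b.+1)%N ->
  e_ominus m (X_ a b.+1) Z =
  e_ominus m (X_ a b) Z + x_ b.+1 * e_ominus (m - 1) (X_ a b) Z.
Proof.
move=> leab; pose K := ((b.+2 - a) + `|m|).+2.
rewrite !(@e_ominusE K); try by rewrite /K; lia.
rewrite mulr_sumr -big_split; apply: eq_bigr => k _ /=.
by rewrite X_recr // eDU mulrDl mulrA addrAC.
Qed.

Lemma e_ominusDU a b m Z v :
  e_ominus m (X_ a b) (Z + << v >>) =
  e_ominus m (X_ a b) Z + indet v * e_ominus (m + 1) (X_ a b) Z.
Proof.
pose K := ((b.+1 - a) + `|m|).+2.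
rewrite (@e_ominusE K) 1?(@e_ominusE K _ _ m) ?(@e_ominusE K.-1 _ _ (m + 1));
  try by rewrite /K; lia.
under eq_bigr do rewrite eDU mulrDr.
rewrite big_split /=; congr (_ + _); rewrite mulr_sumr big_ord_recl.
rewrite [X in X + _](_ : _ = 0) ?add0r; last by rewrite !mulr0.
apply: eq_bigr => k _.
rewrite mulrCA lift0 (_ : m + k.+1%:Z = m + 1 + k); last by lia.
by rewrite (_ : k.+1%:Z - 1 = k) //; lia.
Qed.

End EOminus.

(** * Entries of the matrix *)

Section Entries.
Implicit Types (i j l m a b : nat).

(** Row and column indices start at 0, hence [A_ i] and [A_ j.+1] for $A_{i-1}$ and $A_j$. The other
    arguments stand for [lam i], [mu j], [r j] and [s i]. *)
Definition jt_entry i j l m a b : pseries :=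
  e_ominus (l%:Z - m%:Z - i%:Z + j%:Z) (X_ a b) (A_ i - A_ j.+1 - B_ l + B_ m).

Lemma A_S i : A_ i.+1 = A_ i + << Valpha i.+1 >>.
Proof. by rewrite /A_ big_nat_recr. Qed.

Lemma B_S l : B_ l.+1 = B_ l + << Vbeta l.+1 >>.
Proof. by rewrite /B_ big_nat_recr. Qed.

Lemma A_subE j i : (j <= i)%N ->
  A_ i - A_ j = \sum_(v <- [seq Valpha k | k <- index_iota j.+1 i.+1]) << v >>.
Proof.
move=> le_ji; rewrite /A_ big_map [X in X - _](big_cat_nat (n := j.+1)) //=.
by rewrite addrAC subrr add0r.
Qed.

Lemma B_subE l m : (l <= m)%N ->
  B_ m - B_ l = \sum_(v <- [seq Vbeta k | k <- index_iota l.+1 m.+1]) << v >>.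
Proof.
move=> le_lm; rewrite /B_ big_map [X in X - _](big_cat_nat (n := l.+1)) //=.
by rewrite addrAC subrr add0r.
Qed.

(** The second argument is a plain sum of [i - j - 1] alphas and [m - l] betas, and adding their
    number to the index still leaves it negative. *)
Lemma e_ominus_AB_eq0 i j l m a b (c : int) : (j < i)%N -> (l <= m)%N ->
  c <= l%:Z - m%:Z - i%:Z + j%:Z ->
  e_ominus c (X_ a b) (A_ i - A_ j.+1 - B_ l + B_ m) = 0.
Proof.
move=> ltji lelm lec; rewrite -addrA [- _ + _]addrC A_subE // B_subE //.
rewrite -big_cat /=; apply: e_ominus_sum_lt.
by rewrite size_cat !size_map !size_iota; lia.
Qed.

Lemma e_ominus_lt0 a b (c : int) : c < 0 -> e_ominus c (X_ a b) 0 = 0.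
Proof.
move=> lt0; have := @e_ominus_sum_lt a b c [::]; rewrite big_nil; apply.
by move: lt0 => /=; lia.
Qed.

Lemma jt_entry_eq0 i j l m a b : (j < i)%N -> (l <= m)%N ->
  jt_entry i j l m a b = 0.
Proof. by move=> ltji lelm; apply: e_ominus_AB_eq0. Qed.

Lemma jt_entry_gt i j l m a b :
  (b.+1 - a)%N%:Z < l%:Z - m%:Z - i%:Z + j%:Z -> jt_entry i j l m a b = 0.
Proof. exact: e_ominus_gt. Qed.

(* Either x_{b+1} is available to the entry, or the entry with row length
   decreased by one vanishes, so that x_{b+1} may be added harmlessly. *)
Definition extendable i j l m a b :=
  [|| (a <= b.+1)%N, (m + i + 2 <= l + j)%N | (j < i)%N && (l <= m)%N].

Lemma jt_entry_recr i j l m a b : extendable i j l m a b ->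
  jt_entry i j l m a b.+1 = jt_entry i j l m a b +
    x_ b.+1 * e_ominus (l%:Z - m%:Z - i%:Z + j%:Z - 1) (X_ a b)
                       (A_ i - A_ j.+1 - B_ l + B_ m).
Proof.
have [leab _|ltba /=] := leqP a b.+1; first exact: e_ominus_Xrecr.
(* Both ranges of variables are empty here, so an index of at least 2 stays positive after the
   decrement and the extra term vanishes. In the other case every term vanishes. *)
rewrite /extendable leqNgt ltba /= => /orP[gt2|/andP[ltji lelm]].
  rewrite e_ominus_gt ?mulr0 ?addr0; last by lia.
  by rewrite /jt_entry !X_geq // ltnW.
rewrite !jt_entry_eq0 // add0r e_ominus_AB_eq0 ?mulr0 //.
by rewrite gerBl.
Qed.

Lemma e_ominus_shift a b (c : int) (Z Z' : lincomb) v : Z' = Z + << v >> ->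
  e_ominus (c - 1) (X_ a b) Z' =
  e_ominus (c - 1) (X_ a b) Z + indet v * e_ominus c (X_ a b) Z.
Proof. by move=> ->; rewrite e_ominusDU (subrK 1). Qed.

(** Lowering [l.+1] to [l] lowers the index by one and adds [beta_ l.+1] to the second argument.
    This expresses the correction term of [jt_entry_recr] through entries. *)
Lemma jt_entry_beta i j l m a b : extendable i j l.+1 m a b ->
  jt_entry i j l.+1 m a b.+1 =
  (1 - x_ b.+1 * beta_ l.+1) * jt_entry i j l.+1 m a b
  + x_ b.+1 * jt_entry i j l m a b.
Proof.
move=> ext; rewrite jt_entry_recr //.
have -> : jt_entry i j l m a b =
    e_ominus (l.+1%:Z - m%:Z - i%:Z + j%:Z - 1) (X_ a b)
             (A_ i - A_ j.+1 - B_ l.+1 + B_ m)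
    + beta_ l.+1 * jt_entry i j l.+1 m a b.
  rewrite /jt_entry [in LHS](_ : l%:Z = l.+1%:Z - 1); last by lia.
  rewrite ![in LHS](addrAC _ (- 1)); apply: e_ominus_shift.
  by rewrite B_S opprD [RHS]addrAC addrA subrK.
ring.
Qed.

(** The same elimination, where passing to row [i.+1] lowers the index and adds [alpha_ i.+1]. *)
Lemma jt_entry_alpha i j l m a b : extendable i j l m a b ->
  jt_entry i j l m a b.+1 =
  (1 - alpha_ i.+1 * x_ b.+1) * jt_entry i j l m a b
  + x_ b.+1 * jt_entry i.+1 j l m a b.
Proof.
move=> ext; rewrite jt_entry_recr //.
have -> : jt_entry i.+1 j l m a b =
    e_ominus (l%:Z - m%:Z - i%:Z + j%:Z - 1) (X_ a b)
             (A_ i - A_ j.+1 - B_ l + B_ m)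
    + alpha_ i.+1 * jt_entry i j l m a b.
  rewrite /jt_entry [in LHS](_ : l%:Z - _ - _ + _ = l%:Z - m%:Z - i%:Z + j%:Z - 1);
    last by lia.
  apply: e_ominus_shift.
  by rewrite [RHS]addrAC [in RHS](addrAC (A_ i - A_ j.+1)) [in RHS](addrAC (A_ i)) -A_S.
ring.
Qed.

(** The second argument [Z] reduces to [- << Valpha i.+1 >>]. Adding that indeterminate back gives
    0, which shows that the value at index -1 is [- alpha_ i.+1] times the value at index 0. Each
    new variable thus contributes one factor. *)
Lemma jt_entry_diag i l a b : (0 < a)%N ->
  jt_entry i i l l a b = \prod_(a <= k < b.+1) (1 - alpha_ i.+1 * x_ k).
Proof.
move=> a_gt0; rewrite /jt_entry.
set Z := (Z in e_ominus _ _ Z).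
have ZE : Z + << Valpha i.+1 >> = 0.
  by rewrite /Z A_S opprD addrA subrr add0r subrK addNr.
have -> : l%:Z - l%:Z - i%:Z + i%:Z = 0 by lia.
have base c : (c < a)%N -> e_ominus 0 (X_ a c) Z = 1.
  move=> ltca; have := e_ominusDU a c 0 Z (Valpha i.+1).
  rewrite ZE (@e_ominus_gt _ _ (0 + 1)) ?mulr0 ?addr0; last by lia.
  move=> <-; rewrite (@e_ominusE 1) ?big_ord1 ?X_geq ?e0 ?mulr1 //; lia.
elim: b => [|b IH]; first by rewrite base ?big_geq.
have [leab|ltba] := leqP a b.+1; last by rewrite base ?big_geq.
rewrite big_nat_recr //= -IH e_ominus_Xrecr //.
have := e_ominus_shift a b 0 (esym ZE); rewrite e_ominus_lt0 // => /esym/eqP.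
rewrite addr_eq0 => /eqP ->.
move: (e_ominus _ _ _) (x_ _) => E x; rewrite -/(alpha_ _).
by move: (alpha_ _) => alp; ring.
Qed.

End Entries.

(** * The determinant *)

(** By the pigeonhole principle every permutation sends some row of [S] to a column outside [T], so
    each term of the expansion has a zero factor. *)
Lemma det_zero_block (R : comNzRingType) n (M : 'M[R]_n) (S T : {set 'I_n}) :
  (#|T| < #|S|)%N -> (forall i j, i \in S -> j \notin T -> M i j = 0) ->
  \det M = 0.
Proof.
move=> ltTS M0; rewrite /determinant big1 // => sigma _.
suff [i [Si Tsi]] : exists i, i \in S /\ sigma i \notin T.
  by rewrite (bigD1 i) //= M0 // mul0r mulr0.
apply: contrapT => /forallNP noi.
have /subset_leq_card : [set sigma i | i in S] \subset T.
  apply/fintype.subsetP => _ /imsetP[i Si ->].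
  by have /not_andP[//|/negP] := noi i; rewrite negbK.
by rewrite card_imset; [rewrite leqNgt ltTS | exact: perm_inj].
Qed.

Definition upd (n : nat) (f : 'I_n -> nat) (i : 'I_n) (v : nat) (j : 'I_n) :=
  if j == i then v else f j.

Section JacobiTrudi.
Variable n : nat.
Implicit Types (lam mu r s : 'I_n -> nat) (i j k : 'I_n).

Definition jt_mx lam mu r s : 'M[pseries]_n :=
  \matrix_(i, j) jt_entry i j (lam i) (mu j) (r j) (s i).

(** The flag inequalities are rearranged so that no truncated subtraction occurs. *)
Record admissible lam mu r s : Prop := Admissible {
  adm_lam : {homo lam : i j / (i <= j)%N >-> (j <= i)%N};
  adm_mu : {homo mu : i j / (i <= j)%N >-> (j <= i)%N};
  adm_sub : forall i, (mu i <= lam i)%N;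
  adm_r : forall i j, j = i.+1 :> nat -> (mu i < lam j)%N ->
    (r i + mu j <= r j + mu i)%N;
  adm_s : forall i j, j = i.+1 :> nat -> (mu i < lam j)%N ->
    (s i + lam j <= s j + lam i + 1)%N }.

(* Consecutive columns from i to j share rows, so the flag conditions apply
   along the whole range. *)
Definition linked lam mu i j :=
  forall k k', k' = k.+1 :> nat -> (i <= k)%N -> (k' <= j)%N -> (mu k < lam k')%N.

Lemma linked_ind lam mu (P : 'I_n -> 'I_n -> Prop) :
  (forall i, P i i) ->
  (forall i j k, k = j.+1 :> nat -> (mu j < lam k)%N -> (i <= j)%N ->
    P i j -> P i k) ->
  forall i j, (i <= j)%N -> linked lam mu i j -> P i j.
Proof.
move=> P0 PS i j leij; move: {2}(j - i)%N (erefl (j - i)%N) => d.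
elim: d j leij => [|d IH] j leij dE lij.
  by rewrite (_ : j = i) //; apply/val_inj => /=; lia.
have ltj : (j.-1 < n)%N by apply: leq_ltn_trans (leq_pred _) (ltn_ord j).
have jE : j = (Ordinal ltj).+1 :> nat by rewrite /= prednK //; lia.
have leij' : (i <= Ordinal ltj)%N by rewrite /=; lia.
apply: (PS _ _ _ jE) => //; first by apply: lij.
apply: IH => //=; first by lia.
by move=> k k' kE leik lek'; apply: lij => //; rewrite jE ltnW.
Qed.

Lemma linked_r lam mu r s i j : admissible lam mu r s -> (i <= j)%N ->
  linked lam mu i j -> (r i + mu j <= r j + mu i)%N.
Proof.
move=> adm; move: i j.
apply: (@linked_ind lam mu (fun i j => r i + mu j <= r j + mu i)%N) => // i j k.
move=> kE lt_mu leij IH; by have := adm_r adm kE lt_mu; lia.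
Qed.

(** Each step of the flag condition loses at most 1; the summands [i] and [j] accumulate these
    losses. *)
Lemma linked_s lam mu r s i j : admissible lam mu r s -> (i <= j)%N ->
  linked lam mu i j -> (s i + lam j + i <= s j + lam i + j)%N.
Proof.
move=> adm; move: i j.
apply: (@linked_ind lam mu (fun i j => s i + lam j + i <= s j + lam i + j)%N) => // i j k.
move=> kE lt_mu leij IH; by have := adm_s adm kE lt_mu; lia.
Qed.

Lemma not_linked lam mu r s i j : admissible lam mu r s -> ~ linked lam mu i j ->
  exists k k', [/\ k' = k.+1 :> nat, (i <= k)%N, (k' <= j)%N & (lam k' <= mu k)%N].
Proof.
move=> adm nl; apply: contrapT => nk; apply: nl => k k' kE leik lek'.
by rewrite ltnNge; apply/negP => le; apply: nk; exists k, k'.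
Qed.

Lemma det_jt_mx_short lam mu r s j : admissible lam mu r s ->
  (mu j < lam j)%N -> (s j + mu j + 1 < r j + lam j)%N ->
  \det (jt_mx lam mu r s) = 0.
Proof.
move=> adm ltj short.
(* Rows in S vanish outside the columns in S minus j: a broken link between
   two indices makes the lower left block vanish, and rows a <= j linked to j
   have too large a degree in the columns from j on. *)
pose S := [set a : 'I_n | ((a <= j)%N && `[< linked lam mu a j >])
                       || ((j < a)%N && ~~ `[< linked lam mu j a >])].
have jS : j \in S.
  rewrite inE leqnn /=; apply/orP; left; apply/asboolP => k k' kE lejk.
  by rewrite kE => /(leq_ltn_trans lejk); rewrite ltnn.
apply: (@det_zero_block _ _ _ S (S :\ j)); first by rewrite (cardsD1 j S) jS.
move=> a b Sa Sb; rewrite mxE.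
(* A broken link between columns [b] and [a] gives [lam a <= lam k' <= mu k <= mu b]. *)
have brk k k' : k' = k.+1 :> nat -> (b <= k)%N -> (k' <= a)%N ->
    (lam k' <= mu k)%N -> jt_entry a b (lam a) (mu b) (r b) (s a) = 0.
  move=> kE lebk lek' lek; apply: jt_entry_eq0; first by lia.
  apply: leq_trans (adm_lam adm lek') _.
  by apply: leq_trans lek (adm_mu adm lebk).
have bP : (b <= j)%N /\ (b = j \/ ~ linked lam mu b j) \/
          (j < b)%N /\ linked lam mu j b.
  move: Sb; rewrite !inE; case: eqVneq => [->|_] /=; first by left; split=> //; left.
  case: ltnP => /= [ltjb|lebj]; rewrite ?(leqNgt b) ?ltjb /=.
    by rewrite negbK => /asboolP; right.
  by rewrite orbF => /asboolP nl; left; split=> //; right.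
move: Sa; rewrite inE => /orP[/andP[leaj /asboolP laj]|/andP[ltja /asboolP nlja]].
- have good : (j <= b)%N -> linked lam mu j b ->
      jt_entry a b (lam a) (mu b) (r b) (s a) = 0.
    (* Chaining the flag conditions from [a] to [j] and from [j] to [b] makes the index exceed
       [s a + 1 - r b]. Monotonicity of [lam] and [mu] makes it positive, which covers the case
       where that difference truncates to 0. *)
    move=> lejb ljb; apply: jt_entry_gt.
    have := linked_s adm leaj laj; have := linked_r adm lejb ljb.
    have := adm_mu adm lejb; have := adm_lam adm leaj; lia.
  case: bP => [[lebj [bj|nlbj]]|[ltjb ljb]].
  + rewrite bj in good *; apply: good => // k k' kE lejk.
    by rewrite kE => /(leq_ltn_trans lejk); rewrite ltnn.
  + have [k [k' [kE lebk lek' lek]]] := not_linked adm nlbj.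
    apply: (brk k k') => //; rewrite leqNgt; apply/negP => ltak.
    have := laj k k' kE _ lek'; rewrite ltnNge lek; move=> H.
    by have : (a <= k)%N by [lia]; move/H.
  + by apply: good => //; apply: ltnW.
- have [k [k' [kE lejk lek' lek]]] := not_linked adm nlja.
  apply: (brk k k') => //; case: bP => [[lebj _]|[ltjb ljb]].
    exact: leq_trans lebj lejk.
  rewrite leqNgt; apply/negP => ltkb.
  by have := ljb k k' kE lejk; rewrite kE => /(_ ltkb); rewrite ltnNge lek.
Qed.

Lemma det_jt_mx_empty lam mu r s : admissible lam mu r s ->
  (forall i, (0 < r i)%N) -> (forall i, lam i = mu i) ->
  \det (jt_mx lam mu r s) =
  \prod_(i < n) \prod_(r i <= l < (s i).+1) (1 - alpha_ i.+1 * x_ l).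
Proof.
(* The matrix is upper triangular, while [det_trig] concerns lower triangular ones, hence the
   transposition. *)
move=> adm r_gt0 lamE; rewrite -det_tr det_trig.
  by apply: eq_bigr => i _; rewrite !mxE lamE jt_entry_diag.
apply/is_trig_mxP => i j ltij; rewrite !mxE jt_entry_eq0 //.
by rewrite lamE; apply: (adm_mu adm); apply: ltnW.
Qed.

(** Right of the diagonal the index is at least 2. Elsewhere, unless [j < i] and [lam i <= mu j],
    column [j] is nonempty, and the maximality of [s i - lam i] together with the room in column [j]
    gives [r j <= s i]. *)
Lemma extendable_entry lam mu r s i j b : admissible lam mu r s ->
  (mu i < lam i)%N ->
  (forall k, (mu k < lam k)%N -> (r k + lam k <= s k + mu k + 1)%N) ->
  (forall k, (mu k < lam k)%N -> (s k + lam i <= s i + lam k)%N) ->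
  s i = b.+1 -> extendable i j (lam i) (mu j) (r j) b.
Proof.
move=> adm lti long cmax sE; rewrite /extendable -sE.
have [ltij|ltji|/val_inj <-] := ltngtP i j.
- by apply/orP; right; apply/orP; left; have := adm_mu adm (ltnW ltij); lia.
- rewrite /=; have [_|lt_mu] := leqP (lam i) (mu j); first by rewrite !orbT.
  have ltj : (mu j < lam j)%N by apply: leq_trans lt_mu (adm_lam adm (ltnW ltji)).
  by have := long j ltj; have := cmax j ltj; lia.
- by have := long i lti; lia.
Qed.

Lemma det_jt_mx_step lam mu r s i b : admissible lam mu r s ->
  (mu i < lam i)%N ->
  (forall k, (mu k < lam k)%N -> (r k + lam k <= s k + mu k + 1)%N) ->
  (forall k, (mu k < lam k)%N -> (s k + lam i <= s i + lam k)%N) ->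
  s i = b.+1 ->
  \det (jt_mx lam mu r s) =
  (1 - x_ b.+1 * beta_ (lam i)) * \det (jt_mx lam mu r (upd s i b))
  + x_ b.+1 * \det (jt_mx (upd lam i (lam i).-1) mu r (upd s i b)).
Proof.
move=> adm lti long cmax sE; apply: (determinant_multilinear (i0 := i)).
- apply/rowP => j; rewrite !mxE /upd eqxx.
  have := extendable_entry j adm lti long cmax sE.
  by case: (lam i) lti => [//|l] _; rewrite sE => /jt_entry_beta.
- by apply/matrixP => k j; rewrite !mxE /upd eq_sym (negbTE (neq_lift _ _)).
- by apply/matrixP => k j; rewrite !mxE /upd eq_sym (negbTE (neq_lift _ _)).
Qed.

Lemma det_jt_mx_redundant lam mu r s i i' b : admissible lam mu r s ->
  (mu i < lam i)%N ->
  (forall k, (mu k < lam k)%N -> (r k + lam k <= s k + mu k + 1)%N) ->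
  (forall k, (mu k < lam k)%N -> (s k + lam i <= s i + lam k)%N) ->
  i' = i.+1 :> nat -> lam i' = lam i -> s i' = b -> s i = b.+1 ->
  \det (jt_mx lam mu r s) =
  (1 - alpha_ i.+1 * x_ b.+1) * \det (jt_mx lam mu r (upd s i b)).
Proof.
move=> adm lti long cmax i'E lamE s'E sE.
have neq : (i' == i) = false by apply/eqP => ii; move: i'E; rewrite ii; lia.
(* As [lam i' = lam i] and [s i' = b], the second summand that [jt_entry_alpha] gives for row [i] is
   a multiple of row [i']. Its matrix [N] has two equal rows and contributes nothing. *)
pose N := \matrix_(k, j) if k == i then jt_mx lam mu r s i' j
                         else jt_mx lam mu r s k j.
have detN : \det N = 0.
  apply: (determinant_alternate (i1 := i) (i2 := i')); first by rewrite eq_sym neq.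
  by move=> j; rewrite /N !mxE eqxx neq.
rewrite (determinant_multilinear (i0 := i) (B := jt_mx lam mu r (upd s i b))
  (C := N) (b := 1 - alpha_ i.+1 * x_ b.+1) (c := x_ b.+1)).
- by rewrite detN [X in _ + X]mulr0 [LHS]addr0.
- apply/rowP => j; rewrite !mxE /upd eqxx lamE s'E i'E sE.
  by have := extendable_entry j adm lti long cmax sE => /jt_entry_alpha.
- by apply/matrixP => k j; rewrite !mxE /upd eq_sym (negbTE (neq_lift _ _)).
- by apply/matrixP => k j; rewrite !mxE eq_sym (negbTE (neq_lift _ _)).
Qed.

End JacobiTrudi.

(** * Sums over tableaux *)

Section InfSum.
Variables (R : comNzRingType) (V : choiceType) (I : choiceType).
Variable F : I -> series R V.
Hypothesis summable : forall m, finite_set [set i | F i m != 0]%classic.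
Implicit Types (A B : set I) (m : {mset V}).

Lemma summable_supp A m : finite_set (A `&` (fun i => F i m) @^-1` [set~ 0])%classic.
Proof.
apply: sub_finite_set (summable m) => i [_ /=] /eqP; exact.
Qed.

Lemma infsumU A B : (A `&` B = set0)%classic ->
  infsum (A `|` B)%classic F = infsum A F + infsum B F.
Proof.
move=> AB; apply/funext => m; rewrite series_addE /infsum.
rewrite fsbig_supp setIUl fsbigU0 //; try exact: summable_supp.
  by rewrite -!fsbig_supp.
by move=> i [[Ai _] [Bi _]]; rewrite -[set0]AB.
Qed.

Lemma infsum_mull A (c : series R V) :
  infsum A (fun i => c * F i) = c * infsum A F.
Proof.
apply/funext => m; rewrite series_mulE /infsum.
(* Only finitely many factorizations of [m] occur, so one finite index set serves all the
   coefficients involved and the two sums can be exchanged. *)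
pose S := (A `&` \bigcup_(a in [set` msubs m]) [set i | F i (msetB m a) != 0])%classic.
have finS : finite_set S.
  apply: finite_setIr; apply: bigcup_finite => [|a _]; last exact: summable.
  exact: finite_fset.
rewrite -(@fsbig_widen _ _ _ _ S) => [|i []//|i [Ai Si] /=]; last first.
  rewrite series_mulE big1_seq // => a /andP[_ am]; have [->|nz] := eqVneq (F i (msetB m a)) 0.
    by rewrite mulr0.
  by case: Si; split => //; exists a.
under [RHS]eq_big_seq => a am.
  rewrite -(@fsbig_widen _ _ _ _ S) => [||i [Ai Si] /=]; [|by move=> i []|]; last first.
    by apply/eqP/negPn/negP => nz; case: Si; split => //; exists a.
  rewrite fsbig_finite // mulr_sumr.
  over.
by rewrite fsbig_finite // exchange_big.
Qed.

(** This turns the insertion of an element into a cell into a factor of the generating series. *)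
Lemma infsum_image A (h : I -> I) (c : series R V) : injective h ->
  (forall i, A i -> F (h i) = c * F i) ->
  infsum (h @` A)%classic F = c * infsum A F.
Proof.
move=> injh Fh; rewrite -infsum_mull; apply/funext => m; rewrite /infsum.
rewrite fsbig_image; last by move=> i j _ _; apply: injh.
by apply: eq_fsbigr => i /set_mem Ai; rewrite Fh.
Qed.

End InfSum.

(** * Appending a last element to a marked multiset *)

Section MarkedMultisets.
Implicit Types (S : mmset) (a : nat * bool).

Lemma is_mmsetP S : reflect
  [/\ S != [::], all (fun k => 0 < k)%N (unzip1 S), sorted leq (unzip1 S) &
      forall t, (t < size S)%N -> nth false (unzip2 S) t ->
        (0 < t)%N && (nth 0%N (unzip1 S) t.-1 < nth 0%N (unzip1 S) t)%N]
  (is_mmset S).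
Proof.
apply: (iffP and4P) => -[-> -> ->].
  by move=> /forallP nS; split=> // t ltt; have /implyP := nS (Ordinal ltt).
by move=> nS; split=> //; apply/forallP => t; apply/implyP/nS.
Qed.

Lemma mmax_rcons S a : mmax (rcons S a) = a.1.
Proof. by rewrite /mmax /unzip1 map_rcons last_rcons. Qed.

Lemma mmin_rcons S a : S != [::] -> mmin (rcons S a) = mmin S.
Proof. by case: S. Qed.

Lemma mmin_le_mmax S : is_mmset S -> (mmin S <= mmax S)%N.
Proof.
case/is_mmsetP; case: S => // a S _ _ /= /(order_path_min leq_trans) /allP leS _.
rewrite /mmin /mmax /=; have := mem_last a.1 (unzip1 S).
by rewrite inE => /predU1P[->|/leS].
Qed.

Lemma is_mmset1 a : is_mmset [:: a] = (0 < a.1)%N && ~~ a.2.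
Proof.
apply/is_mmsetP/andP => [[_ /andP[-> _] _ nS]|[a_gt0 aN]].
  by split=> //; apply/negP => a2; have := nS 0%N isT a2.
by split=> //= [|[|t]//=]; rewrite ?a_gt0 // (negbTE aN).
Qed.

(** Order and marks only compare neighbours, so the new element is tested against the last one
    alone; its positivity follows. *)
Lemma is_mmset_rcons S a : S != [::] ->
  is_mmset (rcons S a) =
  [&& is_mmset S, (mmax S <= a.1)%N & a.2 ==> (mmax S < a.1)%N].
Proof.
move=> SN0.
have sortE : sorted leq (unzip1 (rcons S a)) =
    sorted leq (unzip1 S) && (mmax S <= a.1)%N.
  by rewrite /unzip1 map_rcons; case: S SN0 => //= b S _; rewrite rcons_path.
have lastE : nth 0%N (unzip1 S) (size S).-1 = mmax S.
  by rewrite /mmax -(size_map fst) nth_last; case: (S) SN0.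
have nthE t : (t < size S)%N -> (nth false (unzip2 (rcons S a)) t = nth false (unzip2 S) t)
    /\ (nth 0%N (unzip1 (rcons S a)) t = nth 0%N (unzip1 S) t).
  by move=> ltt; rewrite /unzip1 /unzip2 !map_rcons !nth_rcons !size_map ltt.
have nth1E : nth 0%N (unzip1 (rcons S a)) (size S) = a.1.
  by rewrite /unzip1 map_rcons nth_rcons size_map ltnn eqxx.
have nth2E : nth false (unzip2 (rcons S a)) (size S) = a.2.
  by rewrite /unzip2 map_rcons nth_rcons size_map ltnn eqxx.
have S_gt0 : (0 < size S)%N by case: (S) SN0.
apply/is_mmsetP/and3P => [[_ pos sort nS]|[/is_mmsetP[_ pos sort nS] lea lta]].
  move: sort; rewrite sortE => /andP[sort lea]; split=> //.
    apply/is_mmsetP; split=> // [|t ltt].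
      by move: pos; rewrite /unzip1 map_rcons all_rcons => /andP[].
    have := nS t; rewrite size_rcons ltnS (ltnW ltt) !(nthE t ltt).1 (nthE t ltt).2.
    rewrite (nthE t.-1 _).2 => [/(_ isT)//|].
    exact: leq_ltn_trans (leq_pred t) ltt.
  apply/implyP => a2; have := nS (size S).
  rewrite size_rcons ltnSn nth2E nth1E (nthE _ _).2 ?lastE.
    by move=> /(_ isT a2)/andP[].
  by rewrite prednK.
split; first by case: (S).
- rewrite /unzip1 map_rcons all_rcons pos andbT; apply: leq_trans lea.
  by rewrite -lastE; move/all_nthP: pos => /(_ 0%N); apply; rewrite size_map prednK.
- by rewrite sortE sort.
- move=> t; rewrite size_rcons ltnS leq_eqVlt => /predU1P[->|ltt].
    rewrite nth2E nth1E (nthE _ _).2 ?lastE ?prednK // => a2.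
    by rewrite S_gt0 (implyP lta).
  rewrite (nthE t ltt).1 (nthE t ltt).2 (nthE t.-1 _).2; first exact: nS.
  exact: leq_ltn_trans (leq_pred t) ltt.
Qed.

(** The first element is never marked. Hence [(unmarked S).-1] does not truncate, and appending an
    unmarked element really raises it by one. *)
Lemma unmarked_gt0 S : is_mmset S -> (0 < unmarked S)%N.
Proof.
case/is_mmsetP; case: S => // -[k [|]] S _ _ _ nS //.
by have := nS 0%N isT isT.
Qed.

Definition cell_wt (i j : nat) S : pseries :=
  (\prod_(a <- S) x_ a.1) * alpha_ j ^+ (unmarked S).-1 * (- beta_ i) ^+ marked S.

(** The predecessor of 0 is 0, so cells outside a shape may stay in the product of weights. *)
Lemma cell_wt0 i j : cell_wt i j [::] = 1.
Proof. by rewrite /cell_wt big_nil !mulr1. Qed.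

Lemma cell_wt1 i j k : cell_wt i j [:: (k, false)] = x_ k.
Proof. by rewrite /cell_wt big_seq1 !mulr1. Qed.

Lemma cell_wt_rcons i j S k b : is_mmset S ->
  cell_wt i j (rcons S (k, b)) =
  (if b then - (beta_ i * x_ k) else alpha_ j * x_ k) * cell_wt i j S.
Proof.
move=> /unmarked_gt0; rewrite /cell_wt /unmarked /marked -!cats1 !count_cat big_cat.
rewrite big_seq1 /=; case: (count _ S) => // u _; rewrite addn0.
move: (\prod_(_ <- _) _) (x_ k) (alpha_ j) (beta_ i) => P x al be.
by case: b; rewrite /= ?addn0 ?addn1 /= !exprS; ring.
Qed.

End MarkedMultisets.

(** Divisibility of the series [f] by the monomial [d], read off the support. *)
Definition dvd_supp (d : {mset var}) (f : pseries) :=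
  forall m, f m != 0 -> (d `<=` m)%mset.

Lemma dvd_suppM d d' f g : dvd_supp d f -> dvd_supp d' g ->
  dvd_supp (msetD d d') (f * g).
Proof.
move=> df dg m; rewrite series_mulE => nz.
have [[a [am fa ga]]|no] :=
    pselect (exists a, [/\ (a `<=` m)%mset, f a != 0 & g (msetB m a) != 0]).
  by rewrite -(msetBDKC am); apply: msetDSS; [apply: df | apply: dg].
case/eqP: nz; rewrite big1_seq // => a /andP[_]; rewrite in_msubs => am.
apply/eqP; rewrite mulf_eq0; apply/orP.
have [|fa] := eqVneq (f a) 0; first by left.
right; apply/negPn/negP => ga; apply: no; by exists a.
Qed.

Lemma dvd_supp0 f : dvd_supp mset0 f.
Proof. by move=> m _; apply: msub0set. Qed.

Lemma dvd_supp_cell_wt i j S :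
  dvd_supp (seq_mset [seq Vx a.1 | a <- S]) (cell_wt i j S).
Proof.
have dP : dvd_supp (seq_mset [seq Vx a.1 | a <- S]) (\prod_(a <- S) x_ a.1).
  elim: S => [|a S IH].
    by rewrite big_nil => m _; apply/msubsetP => v; rewrite mset_seqE.
  rewrite big_cons /= mset_cons; apply: dvd_suppM IH => m; rewrite /x_ /indet.
  by have [-> _|] := eqVneq m [mset Vx a.1]%mset; [exact: msubset_refl | rewrite eqxx].
by rewrite /cell_wt -mulrA -[seq_mset _]msetD0; apply: dvd_suppM dP _; apply: dvd_supp0.
Qed.

Fixpoint bounded_seqs (A : eqType) (E : seq A) (L : nat) : seq (seq A) :=
  if L is L'.+1 then [::] :: [seq a :: w | a <- E, w <- bounded_seqs E L']
  else [:: [::]].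

Lemma mem_bounded_seqs (A : eqType) (E : seq A) L (S : seq A) :
  (size S <= L)%N -> {subset S <= E} -> S \in bounded_seqs E L.
Proof.
elim: L S => [|L IH] [|a S] //= leS sub.
rewrite inE /=; apply/allpairsP; exists (a, S); split=> //=.
  by apply: sub; rewrite mem_head.
by apply: IH => // b Sb; apply: sub; rewrite inE Sb orbT.
Qed.

(** * Fillings of a box and their generating series *)

Section Boxed.
Variables n N : nat.
Implicit Types (lam mu r s : 'I_n -> nat) (c d : 'I_N * 'I_n).

(* Fillings of a fixed N x n box, so that shapes can vary without changing the
   type; a cell is outside the shape when its list is empty. *)
Local Notation boxed := {ffun 'I_N * 'I_n -> mmset}.
Implicit Types T : boxed.

Definition in_shape lam mu c := (mu c.2 <= c.1 < lam c.2)%N.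

Record boxed_tableau lam mu r s T : Prop := BoxedTableau {
  bt_out : forall c, ~~ in_shape lam mu c -> T c = [::];
  bt_mm : forall c, in_shape lam mu c -> is_mmset (T c);
  bt_r : forall c, in_shape lam mu c -> (r c.2 <= mmin (T c))%N;
  bt_s : forall c, in_shape lam mu c -> (mmax (T c) <= s c.2)%N;
  bt_row : forall c d, d.1 = c.1 -> d.2 = c.2.+1 :> nat ->
    in_shape lam mu c -> in_shape lam mu d -> (mmax (T c) <= mmin (T d))%N;
  bt_col : forall c d, d.1 = c.1.+1 :> nat -> d.2 = c.2 ->
    in_shape lam mu c -> in_shape lam mu d -> (mmax (T c) < mmin (T d))%N }.

Definition boxed_wt T : pseries := \prod_(c : 'I_N * 'I_n) cell_wt c.1.+1 c.2.+1 (T c).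

Definition Gboxed lam mu r s : pseries :=
  infsum [set T | boxed_tableau lam mu r s T]%classic boxed_wt.

Definition set_cell T c S : boxed := [ffun d => if d == c then S else T d].

Lemma set_cell_eq T c S : set_cell T c S c = S.
Proof. by rewrite ffunE eqxx. Qed.

Lemma set_cell_neq T c S d : d != c -> set_cell T c S d = T d.
Proof. by move=> /negbTE dc; rewrite ffunE dc. Qed.

Lemma boxed_wt_set T c S q :
  cell_wt c.1.+1 c.2.+1 S = q * cell_wt c.1.+1 c.2.+1 (T c) ->
  boxed_wt (set_cell T c S) = q * boxed_wt T.
Proof.
move=> SE; rewrite /boxed_wt (bigD1 c) //= [in RHS](bigD1 c) //= set_cell_eq SE.
rewrite -mulrA; congr (_ * (_ * _)).
by apply: eq_bigr => d dc; rewrite set_cell_neq.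
Qed.

Definition add_last c a T : boxed := set_cell T c (rcons (T c) a).

Lemma add_last_inj c a : injective (add_last c a).
Proof.
move=> T T' /ffunP E; apply/ffunP => d; have := E d.
by rewrite !ffunE; case: eqP => [->|_] // /rcons_inj[].
Qed.

Lemma dvd_supp_boxed_wt T c m : boxed_wt T m != 0 ->
  (seq_mset [seq Vx a.1 | a <- T c] `<=` m)%mset.
Proof.
rewrite /boxed_wt (bigD1 c) //=.
have := dvd_suppM (@dvd_supp_cell_wt c.1.+1 c.2.+1 (T c)) (@dvd_supp0 _).
by move=> dw /dw; rewrite msetD0.
Qed.

(** If [m] occurs in the weight of [T], each cell has at most [size m] elements, all of them indices
    of [Vx] indeterminates of [m]. With both markings this leaves a finite list [Q] of possible
    contents per cell. *)
Lemma boxed_wt_summable m : finite_set [set T | boxed_wt T m != 0]%classic.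
Proof.
pose E := [seq (k, b) | k <- pmap (fun v => if v is Vx k then Some k else None)
                                    (enum_mset m), b <- [:: true; false]].
pose Q := bounded_seqs E (size m).
apply: (@sub_finite_set _ _
  ((fun g : {ffun 'I_N * 'I_n -> 'I_(size Q)} =>
      [ffun c => nth [::] Q (g c)] : boxed) @` setT)%classic);
  last by apply: finite_image; apply: finite_finset.
move=> T /= nz.
have TQ c : T c \in Q.
  have sub := dvd_supp_boxed_wt c nz; apply: mem_bounded_seqs.
    rewrite -(size_map (fun a => Vx a.1)) -(perm_size (perm_eq_seq_mset _)).
    by rewrite -(size_msetB sub) leq_addl.
  move=> [k b] Tk; apply/allpairsP; exists (k, b); split=> //=; last by case: b {Tk}.
  rewrite mem_pmap; apply/mapP; exists (Vx k) => //.
  apply: (msubset_subset sub); rewrite in_mset mset_seqE -has_count has_pred1.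
  by apply/mapP; exists (k, b).
have ltQ c : (index (T c) Q < size Q)%N by rewrite index_mem.
exists [ffun c => Ordinal (ltQ c)] => //.
by apply/ffunP => c; rewrite !ffunE /= nth_index.
Qed.

Lemma bt_col_chain lam mu r s T c d : boxed_tableau lam mu r s T ->
  d.2 = c.2 -> (c.1 <= d.1)%N -> in_shape lam mu c -> in_shape lam mu d ->
  (mmax (T c) + (d.1 - c.1) <= mmax (T d))%N.
Proof.
move=> bt; case: c => i j; case: d => k j' /= ->.
move: {2}(k - i)%N (erefl (k - i)%N) => e; elim: e k => [|e IH] k kE leik ci ck.
  by rewrite kE addn0 (_ : k = i) //; apply/val_inj => /=; lia.
have ltk : (k.-1 < N)%N by apply: leq_ltn_trans (leq_pred _) (ltn_ord k).
have k'E : k = (Ordinal ltk).+1 :> nat by rewrite /= prednK //; lia.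
have ck' : in_shape lam mu (Ordinal ltk, j).
  by move: ci ck; rewrite /in_shape /=; lia.
have := IH (Ordinal ltk) _ _ ci ck'; rewrite /= => IH'.
have := @bt_col _ _ _ _ _ bt (Ordinal ltk, j) (k, j) k'E erefl ck' ck.
have := mmin_le_mmax (bt_mm bt ck).
by have := IH' _ _; move: kE leik; lia.
Qed.

Lemma Gboxed_short lam mu r s j : (forall k, (lam k <= N)%N) ->
  (mu j < lam j)%N -> (s j + mu j + 1 < r j + lam j)%N -> Gboxed lam mu r s = 0.
Proof.
move=> leN ltj short; apply/funext => m; rewrite /Gboxed /infsum fsbig1 // => T bt.
have lt1 : (mu j < N)%N by apply: leq_trans (leN j).
have lt2 : ((lam j).-1 < N)%N by apply: leq_trans (leN j); rewrite prednK // (leq_trans _ ltj).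
pose c := (Ordinal lt1, j); pose d := (Ordinal lt2, j).
have ci : in_shape lam mu c by rewrite /in_shape /=; lia.
have di : in_shape lam mu d by rewrite /in_shape /=; lia.
have := bt_col_chain bt (erefl : d.2 = c.2) _ ci di; have := bt_s bt di.
by have := bt_r bt ci; have := mmin_le_mmax (bt_mm bt ci); rewrite /=; lia.
Qed.

Lemma Gboxed_empty lam mu r s : (forall i, lam i = mu i) -> Gboxed lam mu r s = 1.
Proof.
move=> lamE; have out c : ~~ in_shape lam mu c by rewrite /in_shape lamE; lia.
rewrite /Gboxed (_ : [set _ | _]%classic = [set [ffun=> [::]] : boxed]%classic).
  apply/funext => m; rewrite /infsum fsbig_set1 /boxed_wt big1 // => c _.
  by rewrite ffunE cell_wt0.
apply/seteqP; split => [T bt|T ->] /=.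
  by apply/ffunP => c; rewrite ffunE (bt_out bt).
by split=> [c|c /(negP (out c))|c /(negP (out c))|c /(negP (out c))
  |c d _ _ /(negP (out c))|c d _ _ /(negP (out c))] //; rewrite ffunE.
Qed.

End Boxed.

(** * The recurrences for tableaux *)

Section LastCell.
Variables (n N : nat) (lam mu r s : 'I_n -> nat) (i : 'I_n) (b : nat).
Hypotheses (adm : admissible lam mu r s) (leN : forall k, (lam k <= N)%N).
Hypotheses (lt_mu : (mu i < lam i)%N) (long : (r i <= s i)%N) (sE : s i = b.+1).
Hypothesis cmax : forall k, (mu k < lam k)%N -> (s k + lam i <= s i + lam k)%N.
Local Notation boxed := {ffun 'I_N * 'I_n -> mmset}.
Implicit Types (T : boxed) (c d : 'I_N * 'I_n).

Let ltrow : ((lam i).-1 < N)%N.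
Proof. by apply: leq_trans (leN i); rewrite prednK // (leq_trans _ lt_mu). Qed.

(** The bottom cell of column [i]; rows of the box start at 0. *)
Let c0 : 'I_N * 'I_n := (Ordinal ltrow, i).
Let s' := upd s i b.
Let lam' := upd lam i (lam i).-1.

Let c0_in : in_shape lam mu c0.
Proof. by rewrite /in_shape /=; move: lt_mu; lia. Qed.

Let c0P c : reflect (c.1 = (lam i).-1 :> nat /\ c.2 = i) (c == c0).
Proof.
case: c => k j; rewrite xpair_eqE /=; apply: (iffP andP) => [[/eqP-> /eqP->]//|].
by move=> [/= kE ->]; split=> //; apply/eqP/val_inj.
Qed.

Let in_shape' c : in_shape lam' mu c = in_shape lam mu c && (c != c0).
Proof.
case: c => k j; rewrite /in_shape /lam' /upd /=; case: eqVneq => [->|ji].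
  have -> : ((k, i) != c0) = (k != (lam i).-1 :> nat).
    by congr (~~ _); apply/c0P/eqP => [[]|].
  by move: lt_mu; lia.
by rewrite (_ : (k, j) != c0) ?andbT //; apply/c0P => -[_ /= E]; rewrite E eqxx in ji.
Qed.

Let col_lt T c : boxed_tableau lam mu r s T -> in_shape lam mu c -> c.2 = i ->
  c != c0 -> (mmax (T c) < mmin (T c0))%N.
Proof.
move=> bt cin ci cNc0.
have ltc : (c.1 < (lam i).-1)%N.
  have : c.1 != (lam i).-1 :> nat by apply: contra cNc0 => /eqP cE; apply/c0P.
  by move: cin; rewrite /in_shape ci; lia.
have ltd : ((lam i).-2 < N)%N by apply: leq_ltn_trans ltrow; rewrite leq_pred.
pose d : 'I_N * 'I_n := (Ordinal ltd, i).
have din : in_shape lam mu d by move: cin; rewrite /in_shape /= ci; lia.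
have := @bt_col_chain _ _ _ _ _ _ _ _ d bt (esym ci); rewrite /= => chain.
have := @bt_col _ _ _ _ _ _ _ bt d c0; rewrite /= => /(_ _ erefl din c0_in).
by move: chain => /(_ _ cin din); lia.
Qed.

(* v is a legal minimum for the cell c0, given its left and upper neighbours. *)
Definition low T v :=
  [/\ (r i <= v)%N,
      forall d, d.1 = c0.1 -> i = d.2.+1 :> nat -> in_shape lam mu d ->
        (mmax (T d) <= v)%N
    & forall d, c0.1 = d.1.+1 :> nat -> d.2 = i -> in_shape lam mu d ->
        (mmax (T d) < v)%N].

Lemma low_set_cell T S v : low (set_cell T c0 S) v <-> low T v.
Proof.
have neq1 d : i = d.2.+1 :> nat -> d != c0.
  by move=> iE; apply/c0P => -[_ di]; move: iE; rewrite di; lia.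
have neq2 d : c0.1 = d.1.+1 :> nat -> d != c0.
  by move=> cE; apply/eqP => dE; move: cE; rewrite dE; lia.
by split=> -[rv lv av]; split=> // d d1 d2 din; [have := lv d d1 d2 din|
  have := av d d1 d2 din | have := lv d d1 d2 din | have := av d d1 d2 din];
  rewrite set_cell_neq //; auto.
Qed.

(** Column strictness keeps the other cells of column [i] below [c0], so lowering the flag by one
    only affects [c0]. *)
Lemma boxed_tableau_pred T :
  boxed_tableau lam mu r s' T <->
  boxed_tableau lam mu r s T /\ (mmax (T c0) <= b)%N.
Proof.
split=> [bt|[bt leb]].
  split; last by have := bt_s bt c0_in; rewrite /s' /upd eqxx.
  split; try by case: bt.
  move=> c cin; apply: leq_trans (bt_s bt cin) _; rewrite /s' /upd.
  by case: eqP => // ->; rewrite sE.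
split; try by case: bt.
move=> c cin; rewrite /s' /upd; case: eqP => [ci|_]; last exact: (bt_s bt cin).
have [->//|cN] := eqVneq c c0; apply: leq_trans leb.
apply: leq_trans (mmin_le_mmax (bt_mm bt c0_in)).
by apply/ltnW/(col_lt bt).
Qed.

(** Column [i'] also reaches the row of [c0], and the neighbour of [c0] there is bounded by
    [s i' = b]. *)
Lemma Gboxed_redundant (i' : 'I_n) : i' = i.+1 :> nat -> lam i' = lam i -> s i' = b ->
  Gboxed N lam mu r s = Gboxed N lam mu r s'.
Proof.
move=> i'E lamE s'E; congr (infsum _ _); apply/seteqP; split=> T; last first.
  by case/boxed_tableau_pred.
move=> bt; apply/boxed_tableau_pred; split=> //.
pose d : 'I_N * 'I_n := (Ordinal ltrow, i').
have din : in_shape lam mu d.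
  have /= := adm_mu adm (_ : i <= i')%N; rewrite i'E leqnSn => /(_ isT).
  by move: c0_in; rewrite /in_shape /= lamE; lia.
apply: leq_trans (bt_row bt (erefl : d.1 = c0.1) i'E c0_in din) _.
by rewrite -s'E; apply: leq_trans (mmin_le_mmax (bt_mm bt din)) (bt_s bt din).
Qed.

Hypothesis lam_next : forall i' : 'I_n, i' = i.+1 :> nat -> (lam i' < lam i)%N.

(** By [lam_next] nothing lies to the right of [c0], and nothing lies below it, so its content is
    constrained only by its flag and by [low]. The rest of column [i] stays strictly below [c0],
    hence respects the smaller flag [b]. *)
Lemma boxed_tableau_last T :
  boxed_tableau lam mu r s T <->
  [/\ boxed_tableau lam' mu r s' (set_cell T c0 [::]), is_mmset (T c0),
      (mmax (T c0) <= b.+1)%N & low T (mmin (T c0))].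
Proof.
split=> [bt|[bt mm lemax [rv lv av]]].
  split; [|exact: (bt_mm bt c0_in)|by rewrite -sE; exact: (bt_s bt c0_in)|].
    split.
    - move=> c; rewrite in_shape' negb_and negbK.
      have [->|cN] := eqVneq c c0; first by rewrite set_cell_eq.
      by rewrite orbF set_cell_neq //; apply: (bt_out bt).
    - move=> c; rewrite in_shape' => /andP[cin cN].
      by rewrite set_cell_neq //; apply: (bt_mm bt cin).
    - move=> c; rewrite in_shape' => /andP[cin cN].
      by rewrite set_cell_neq //; apply: (bt_r bt cin).
    - move=> c; rewrite in_shape' => /andP[cin cN]; rewrite set_cell_neq //.
      rewrite /s' /upd; case: eqP => [ci|_]; last exact: (bt_s bt cin).
      have := col_lt bt cin ci cN; have := mmin_le_mmax (bt_mm bt c0_in).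
      by have := bt_s bt c0_in; rewrite /= sE; lia.
    - move=> c d d1 d2; rewrite !in_shape' => /andP[cin cN] /andP[din dN].
      by rewrite !set_cell_neq //; apply: (bt_row bt d1 d2 cin din).
    - move=> c d d1 d2; rewrite !in_shape' => /andP[cin cN] /andP[din dN].
      by rewrite !set_cell_neq //; apply: (bt_col bt d1 d2 cin din).
  split.
  - exact: (bt_r bt c0_in).
  - by move=> d d1 d2 din; apply: (bt_row bt) din c0_in.
  - by move=> d d1 d2 din; apply: (bt_col bt) din c0_in.
have in' c : in_shape lam mu c -> c != c0 -> in_shape lam' mu c.
  by move=> cin cN; rewrite in_shape' cin cN.
split.
- move=> c cout; have cN : c != c0 by apply: contraNneq cout => ->; apply: c0_in.
  rewrite -(set_cell_neq T [::] cN); apply: (bt_out bt).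
  by rewrite in_shape' negb_and cout.
- move=> c cin; have [->//|cN] := eqVneq c c0.
  by rewrite -(set_cell_neq T [::] cN); apply: (bt_mm bt); apply: in'.
- move=> c cin; have [->//|cN] := eqVneq c c0.
  by rewrite -(set_cell_neq T [::] cN); apply: (bt_r bt); apply: in'.
- move=> c cin; have [->|cN] := eqVneq c c0; first by rewrite sE.
  rewrite -(set_cell_neq T [::] cN); apply: leq_trans (bt_s bt (in' _ cin cN)) _.
  by rewrite /s' /upd; case: eqP => // ->; rewrite sE.
- move=> c d d1 d2 cin din; have [cE|cN] := eqVneq c c0.
    move: d2 d1; rewrite cE /= => /lam_next lt d1.
    by move: din; rewrite /in_shape d1 /=; move: lt; lia.
  have [dE|dN] := eqVneq d c0.
    by rewrite dE in d1 d2 *; apply: lv.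
  rewrite -(set_cell_neq T [::] cN) -(set_cell_neq T [::] dN).
  by apply: (bt_row bt) d1 d2 _ _; apply: in'.
- move=> c d d1 d2 cin din; have [cE|cN] := eqVneq c c0.
    by move: din; rewrite /in_shape d1 d2 cE /=; move: lt_mu; lia.
  have [dE|dN] := eqVneq d c0.
    by rewrite dE in d1 d2 *; apply: av.
  rewrite -(set_cell_neq T [::] cN) -(set_cell_neq T [::] dN).
  by apply: (bt_col bt) d1 d2 _ _; apply: in'.
Qed.

(** This makes the single element [b.+1] legal in [c0]. From the left neighbour [d], go down its
    column to the bottom cell: the maxima grow by at least [lam d.2 - lam i] and end at most at
    [s d.2], so [cmax] bounds the first one by [s i]. *)
Lemma low_top T : boxed_tableau lam' mu r s' T -> low T b.+1.
Proof.
move=> bt; split=> [|d d1 d2 din|d d1 d2 din]; first by rewrite -sE.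
  have din' : in_shape lam' mu d.
    by rewrite in_shape' din; apply/c0P => -[_ di]; move: d2; rewrite di; lia.
  have ltj : (lam d.2 <= N)%N by [].
  have dN : (d.2 == i) = false by apply/eqP => di; move: d2; rewrite di; lia.
  have ltd : ((lam d.2).-1 < N)%N.
    by apply: leq_trans ltj; rewrite prednK //; move: din; rewrite /in_shape; lia.
  pose d' : 'I_N * 'I_n := (Ordinal ltd, d.2).
  have lei : (lam i <= lam d.2)%N by apply: (adm_lam adm); rewrite d2.
  have d'in : in_shape lam' mu d'.
    by rewrite /in_shape /lam' /upd /= dN; move: din; rewrite /in_shape; lia.
  have := @bt_col_chain _ _ _ _ _ _ _ d d' bt erefl _ din' d'in.
  have := bt_s bt d'in; rewrite /s' /upd /= dN d1 /=.
  have := @cmax d.2; rewrite sE.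
  by move: din; rewrite /in_shape d1 /=; lia.
have din' : in_shape lam' mu d.
  by rewrite in_shape' din; apply/c0P => -[dE _]; move: d1; rewrite dE /=; lia.
by have := bt_s bt din'; rewrite /s' /upd d2 eqxx.
Qed.

Lemma add_last_Tab T a : a \in [:: (b.+1, false); (b.+1, true)] ->
  boxed_tableau lam' mu r s' (set_cell T c0 [::]) ->
  is_mmset (rcons (T c0) a) -> low T (mmin (rcons (T c0) a)) ->
  boxed_tableau lam mu r s (add_last c0 a T).
Proof.
move=> aE bt mm lo; apply/boxed_tableau_last; rewrite /add_last set_cell_eq.
rewrite mmax_rcons; split=> //; last by apply/low_set_cell.
  rewrite (_ : set_cell _ _ _ = set_cell T c0 [::]) //.
  by apply/ffunP => d; rewrite !ffunE; case: eqP.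
by move: aE; rewrite !inE => /orP[]/eqP ->.
Qed.

Let Tab := [set T : boxed | boxed_tableau lam mu r s T]%classic.
Let Tab_s := [set T : boxed | boxed_tableau lam mu r s' T]%classic.
Let Tab_ls := [set T : boxed | boxed_tableau lam' mu r s' T]%classic.

(** The classes, in order: [b.+1] is absent from [c0]; it is an unmarked last element after others;
    it is a marked last element; it is alone. An unmarked element may repeat its predecessor, so the
    second class uses [Tab]; a mark requires a strict increase, so the third uses [Tab_s]. *)
Lemma Tab_split : Tab = (Tab_s `|` add_last c0 (b.+1, false) @` Tab `|`
  add_last c0 (b.+1, true) @` Tab_s `|` add_last c0 (b.+1, false) @` Tab_ls)%classic.
Proof.
apply/seteqP; split => T.
  move=> bt; have /boxed_tableau_last[bt0 mm lemax lo] := bt.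
  case/lastP E : (T c0) mm lemax lo => [|S a] mm lemax lo; first by case/is_mmsetP: mm.
  move: lemax; rewrite mmax_rcons leq_eqVlt => /predU1P[aE|lta]; last first.
    do 3 left; apply/boxed_tableau_pred; split=> //.
    by rewrite E mmax_rcons.
  pose T' := set_cell T c0 S.
  have TE : T = add_last c0 (b.+1, a.2) T'.
    apply/ffunP => d; rewrite !ffunE eqxx -aE -surjective_pairing.
    by case: eqP => [->|].
  have bt0' : boxed_tableau lam' mu r s' (set_cell T' c0 [::]).
    rewrite (_ : set_cell _ _ _ = set_cell T c0 [::]) //.
    by apply/ffunP => d; rewrite !ffunE; case: eqP.
  have [SE|SN] := eqVneq S [::].
    right; exists T'; last first.
      by rewrite [RHS]TE; move: mm; rewrite SE is_mmset1 => /andP[_ /negbTE ->].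
    by rewrite /= /T' SE.
  move: mm; rewrite is_mmset_rcons // => /and3P[mm lea lta].
  rewrite mmin_rcons // in lo.
  have btT' : boxed_tableau lam mu r s T'.
    apply/boxed_tableau_last; rewrite set_cell_eq; split=> //; first by rewrite -aE.
    exact/low_set_cell.
  have [a2|a2] := boolP a.2; rewrite ?a2 ?(negbTE a2) /= in TE lta.
    left; right; exists T' => //; apply/boxed_tableau_pred; split=> //.
    by rewrite set_cell_eq -ltnS -aE.
  by do 2 left; right; exists T'.
have bt0P T' : boxed_tableau lam mu r s T' ->
    [/\ boxed_tableau lam' mu r s' (set_cell T' c0 [::]), is_mmset (T' c0),
      T' c0 != [::], (mmax (T' c0) <= b.+1)%N & low T' (mmin (T' c0))].
  by move=> /boxed_tableau_last[bt mm le lo]; split=> //; case/is_mmsetP: mm.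
case=> [[[|]|]|].
- by move=> /boxed_tableau_pred[].
- move=> [T' /bt0P[bt mm N0 le lo] <-]; apply: add_last_Tab; rewrite ?inE ?eqxx //.
    by rewrite is_mmset_rcons // mm le.
  by rewrite mmin_rcons.
- move=> [T' /boxed_tableau_pred[/bt0P[bt mm N0 _ lo] le] <-].
  apply: add_last_Tab; rewrite ?inE ?eqxx ?orbT //.
    by rewrite is_mmset_rcons // mm /= ltnS le leqW.
  by rewrite mmin_rcons.
- move=> [T' bt <-]; have T'0 : T' c0 = [::].
    by apply: (bt_out bt); rewrite in_shape' eqxx andbF.
  apply: add_last_Tab; rewrite ?T'0 ?is_mmset1 ?inE ?eqxx //.
    rewrite (_ : set_cell _ _ _ = T') //.
    by apply/ffunP => d; rewrite !ffunE; case: eqP => [->|].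
  exact: low_top.
Qed.

Lemma Gboxed_step :
  (1 - alpha_ i.+1 * x_ b.+1) * Gboxed N lam mu r s =
  (1 - x_ b.+1 * beta_ (lam i)) * Gboxed N lam mu r s'
  + x_ b.+1 * Gboxed N lam' mu r s'.
Proof.
have wtE : forall T a, is_mmset (T c0) -> boxed_wt (add_last c0 (b.+1, a) T) =
    (if a then - (beta_ (lam i) * x_ b.+1) else alpha_ i.+1 * x_ b.+1) * boxed_wt T.
  have rowE : c0.1.+1 = lam i by rewrite prednK // (leq_trans _ lt_mu).
  by move=> T a mm; rewrite -rowE; apply: boxed_wt_set; apply: cell_wt_rcons.
(* The second term comes from the class indexed by all tableaux; moving it to the left produces the
   factor [1 - alpha_ i.+1 * x_ b.+1]. *)
have GE : Gboxed N lam mu r s = Gboxed N lam mu r s'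
    + alpha_ i.+1 * x_ b.+1 * Gboxed N lam mu r s
    + - (beta_ (lam i) * x_ b.+1) * Gboxed N lam mu r s'
    + x_ b.+1 * Gboxed N lam' mu r s'.
  have D1 (X : set boxed) a : (Tab_s `&` add_last c0 (b.+1, a) @` X = set0)%classic.
    apply/seteqP; split=> // T [/boxed_tableau_pred[_ le] [T' _ TE]].
    by move: le; rewrite -TE set_cell_eq mmax_rcons ltnn.
  have D2 (X Y : set boxed) : (add_last c0 (b.+1, false) @` X
      `&` add_last c0 (b.+1, true) @` Y = set0)%classic.
    apply/seteqP; split=> // T [[T1 _ <-] [T2 _ /ffunP/(_ c0)]].
    by rewrite !set_cell_eq => /rcons_inj[].
  have D3 : (add_last c0 (b.+1, false) @` Tab
      `&` add_last c0 (b.+1, false) @` Tab_ls = set0)%classic.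
    apply/seteqP; split=> // T [[T1 bt1 <-] [T2 bt2 /add_last_inj E]].
    have /is_mmsetP[] := bt_mm bt1 c0_in; rewrite -E (bt_out bt2) //.
    by rewrite in_shape' eqxx andbF.
  rewrite {1}/Gboxed -/Tab Tab_split.
  have sm := @boxed_wt_summable n N.
  rewrite (infsumU sm); last by rewrite !setIUl D1 D3 setIC D2 !setU0.
  rewrite (infsumU sm); last by rewrite setIUl D1 D2 setU0.
  rewrite (infsumU sm); last exact: D1.
  rewrite (infsum_image sm (c := alpha_ i.+1 * x_ b.+1) (@add_last_inj _ _ _ _)); last first.
    by move=> T bt; apply: wtE; apply: (bt_mm bt c0_in).
  rewrite (infsum_image sm (c := - (beta_ (lam i) * x_ b.+1))
    (@add_last_inj _ _ _ _)); last first.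
    by move=> T bt; apply: wtE; apply: (bt_mm bt c0_in).
  rewrite (infsum_image sm (c := x_ b.+1) (@add_last_inj _ _ _ _)) //.
  move=> T bt; have T0 : T c0 = [::].
    by apply: (bt_out bt); rewrite in_shape' eqxx andbF.
  by apply: boxed_wt_set; rewrite T0 cell_wt1 cell_wt0 mulr1.
move: (alpha_ _) (beta_ _) (x_ _) GE => al be x.
move: (Gboxed _ _ _ _ _) (Gboxed _ _ _ _ _) (Gboxed _ _ _ _ _) => G1 G2 G3 E.
by rewrite mulrBl mul1r {1}E; ring.
Qed.

End LastCell.

(** * Induction on the sum of the upper flags *)

Lemma indet_mset0 v : (indet v : pseries) mset0 = 0.
Proof. by rewrite /indet eq_sym -size_mset_eq0 enum_msetn. Qed.

Lemma unit_1Bax i l : 1 - alpha_ i * x_ l \is a GRing.unit.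
Proof.
apply: series_unit1; rewrite series_addE series_oppE series_mul_mset0.
by rewrite /alpha_ !indet_mset0 mul0r subr0 series_oneE eqxx.
Qed.

Section Induction.
Variables (n N : nat).
Implicit Types (lam mu r s : 'I_n -> nat).

Definition jt_factor r s : pseries :=
  \prod_(i < n) \prod_(r i <= l < (s i).+1) (1 - alpha_ i.+1 * x_ l)^-1.

Lemma jt_factor_upd r s i b : s i = b.+1 -> (r i <= b.+1)%N ->
  jt_factor r s = (1 - alpha_ i.+1 * x_ b.+1)^-1 * jt_factor r (upd s i b).
Proof.
move=> sE leri; rewrite /jt_factor (bigD1 i) //= [in RHS](bigD1 i) //= sE.
rewrite /upd eqxx big_nat_recr //= [X in X * _]mulrC -!mulrA.
by congr (_ * (_ * _)); apply: eq_bigr => j /negbTE ->.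
Qed.

(** Only the pair formed by [i] and the index before it could break. There the maximality of
    [s i - lam i] gives the old flag condition with one unit to spare. *)
Lemma admissible_upd_s lam mu r s i b : admissible lam mu r s ->
  (mu i < lam i)%N -> s i = b.+1 ->
  (forall k, (mu k < lam k)%N -> (s k + lam i <= s i + lam k)%N) ->
  admissible lam mu r (upd s i b).
Proof.
move=> adm lti sE cmax; split; try by case: adm.
move=> j k kE ltjk; have := adm_s adm kE ltjk; rewrite /upd.
case: (eqVneq k i) => [ki|_]; case: (eqVneq j i) => [->|ji]; rewrite ?sE; try lia.
  by move=> _; rewrite ki; lia.
move: (ltjk); rewrite ki => ltji.
have : (lam i <= lam j)%N by apply: (adm_lam adm); rewrite -ki kE.
by have := cmax j; rewrite sE; lia.
Qed.

(** The difference [s i - lam i] is unchanged, so the flag conditions persist; the strict drop after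
    [i] keeps the shape a partition. *)
Lemma admissible_upd lam mu r s i b : admissible lam mu r s ->
  (mu i < lam i)%N -> s i = b.+1 ->
  (forall i' : 'I_n, i' = i.+1 :> nat -> (lam i' < lam i)%N) ->
  admissible (upd lam i (lam i).-1) mu r (upd s i b).
Proof.
move=> adm lti sE lam_next; split.
- move=> j k lejk; rewrite /upd.
  case: (eqVneq j i) => [ji|ji]; case: (eqVneq k i) => [ki|ki] //;
    last exact: adm_lam adm _ _ lejk.
    have lti' : (i < k)%N.
      by rewrite ltn_neqAle -ji lejk andbT ji eq_sym; apply: contra ki => /eqP/val_inj ->.
    have ltn' : (i.+1 < n)%N by apply: leq_ltn_trans lti' _.
    have := lam_next (Ordinal ltn') erefl.
    by have := @adm_lam _ _ _ _ _ adm (Ordinal ltn') k lti'; lia.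
  by have := adm_lam adm lejk; rewrite ki; lia.
- exact: adm_mu adm.
- by move=> k; have := adm_sub adm k; rewrite /upd; case: eqP => [->|_]; lia.
- move=> j k kE; rewrite /upd; case: eqP => [ki|_] ltjk; apply: (adm_r adm kE) => //.
  by rewrite ki; lia.
- move=> j k kE; rewrite /upd; have := adm_s adm kE.
  case: (eqVneq j i) => [->|ji]; case: (eqVneq k i) => [->|ki]; rewrite ?sE; lia.
Qed.

Lemma Gboxed_jt lam mu r s : admissible lam mu r s ->
  (forall i, (0 < r i)%N) -> (forall i, (lam i <= N)%N) ->
  Gboxed N lam mu r s = jt_factor r s * \det (jt_mx lam mu r s).
Proof.
move=> adm r_gt0; move: {2}(\sum_i s i)%N (erefl (\sum_i s i)%N) => K.
elim/ltn_ind: K lam s adm => K IH lam s adm sK leN.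
have [/existsP[j /andP[ltj short]]|noshort] :=
    boolP [exists j, (mu j < lam j)%N && (s j + mu j + 1 < r j + lam j)%N].
  by rewrite (Gboxed_short leN ltj short) (det_jt_mx_short adm ltj short) mulr0.
have long k : (mu k < lam k)%N -> (r k + lam k <= s k + mu k + 1)%N.
  move=> ltk; rewrite leqNgt; apply: contra noshort => short.
  by apply/existsP; exists k; rewrite ltk.
have [/existsP[j0 lt0]|empty] := boolP [exists j, (mu j < lam j)%N]; last first.
  have lamE k : lam k = mu k.
    apply/eqP; rewrite eqn_leq (adm_sub adm) andbT leqNgt.
    by apply: contra empty => ltk; apply/existsP; exists k.
  rewrite Gboxed_empty // (det_jt_mx_empty adm) // -big_split big1 // => i _.
  by rewrite -big_split big1 // => l _; apply: mulVr; apply: unit_1Bax.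
(* Maximizing key means maximizing s k - lam k, ties going to the larger k. *)
pose key k := ((s k + (N - lam k)) * n + k)%N.
have [i lti imax] := @arg_maxnP _ j0 (fun k : 'I_n => mu k < lam k)%N key lt0.
have keyle k : (mu k < lam k)%N -> (s k + (N - lam k) <= s i + (N - lam i))%N.
  move=> /imax; rewrite /key => lek; rewrite leqNgt; apply/negP => lt.
  (* A strict gain in the first component of [key] counts at least [n], more than the tie-breaking
     term [i] can offset. *)
  have := leq_mul lt (leqnn n); rewrite mulSn.
  by have := ltn_ord i; lia.
have keyeq k : (mu k < lam k)%N -> (i < k)%N ->
    (s k + (N - lam k) < s i + (N - lam i))%N.
  move=> ltk ltik; rewrite ltn_neqAle keyle // andbT; apply/eqP => E.
  by have := imax k ltk; rewrite /key E; lia.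
have cmax k : (mu k < lam k)%N -> (s k + lam i <= s i + lam k)%N.
  by move=> /keyle; have := leN i; have := leN k; lia.
have leri : (r i <= s i)%N by have := long i lti; lia.
have [b sE] : exists b, s i = b.+1.
  by exists (s i).-1; rewrite prednK //; apply: leq_trans (r_gt0 i) leri.
have sK' : (\sum_k upd s i b k < K)%N.
  rewrite -sK (bigD1 i) //= [X in (_ < X)%N](bigD1 i) //= /upd eqxx sE addSn ltnS.
  by rewrite leq_add2l; apply: leq_sum => k /negbTE ->.
have leri' : (r i <= b.+1)%N by rewrite -sE.
have IHs := IH _ sK' lam _ (admissible_upd_s adm lti sE cmax) erefl leN.
have U := unit_1Bax i.+1 b.+1.
have [/existsP[i' /andP[/eqP i'E /eqP lamE]]|next] :=
    boolP [exists i' : 'I_n, (i' == i.+1 :> nat) && (lam i' == lam i)].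
  have lti' : (mu i < lam i')%N by rewrite lamE.
  have ltii' : (i < i')%N by rewrite i'E.
  have s'E : s i' = b.
    have lti'' : (mu i' < lam i')%N := leq_ltn_trans (adm_mu adm (ltnW ltii')) lti'.
    by have := keyeq i' lti'' ltii'; have := adm_s adm i'E lti'; rewrite lamE sE; lia.
  rewrite (Gboxed_redundant adm leN lti leri sE i'E lamE s'E) IHs.
  rewrite (det_jt_mx_redundant adm lti long cmax i'E lamE s'E sE).
  by rewrite (jt_factor_upd sE leri') [RHS]mulrACA (mulVr U) [RHS]mul1r.
have lam_next (i' : 'I_n) : i' = i.+1 :> nat -> (lam i' < lam i)%N.
  move=> i'E; rewrite ltn_neqAle (adm_lam adm) ?i'E // andbT.
  by apply: contra next => lamE; apply/existsP; exists i'; rewrite i'E eqxx.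
have leN' k : (upd lam i (lam i).-1 k <= N)%N.
  by have := leN k; rewrite /upd; case: eqP => [->|_]; lia.
have IHls := IH _ sK' _ _ (admissible_upd adm lti sE lam_next) erefl leN'.
have := Gboxed_step adm leN lti leri sE cmax lam_next.
rewrite IHs IHls (jt_factor_upd sE leri') (det_jt_mx_step adm lti long cmax sE).
move: (Gboxed _ _ _ _ _) (jt_factor _ _) (\det _) (\det _) U => G D d1 d2.
(* The recurrence gives the series multiplied by [1 - al * x], a unit that is cancelled here. *)
move: (alpha_ _) (beta_ _) (x_ _) => al be x U step; apply: (mulrI U).
rewrite step [RHS]mulrA [X in _ = X * _]mulrA (mulrV U) [X in _ = X * _]mul1r; ring.
Qed.

End Induction.

(** * From fillings of the skew shape to fillings of the box *)

Section Cells.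
Variables (n N : nat) (lam mu : 'I_n -> nat).
Hypothesis leN : forall k, (lam k <= N)%N.
Local Notation boxed := {ffun 'I_N * 'I_n -> mmset}.
Implicit Types (B : boxed) (c d : cell lam mu).

Definition cell_pos c : 'I_N * 'I_n :=
  (widen_ord (leN (colidx c)) (tagged (val c)), colidx c).

Lemma cell_pos_inj : injective cell_pos.
Proof.
move=> [[j k] p] [[j' k'] p'] /eqP; rewrite xpair_eqE /=.
move=> /andP[/eqP/(congr1 val) /= kE /eqP]; rewrite /colidx /= => jE; subst j'.
by apply: val_inj => /=; rewrite (val_inj kE).
Qed.

Lemma cell_pos_in c : in_shape lam mu (cell_pos c).
Proof. by rewrite /in_shape /= ltn_ord andbT; apply: valP c. Qed.

Lemma cell_posP p : in_shape lam mu p -> exists c, cell_pos c = p.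
Proof.
case: p => k j /andP[/= lek ltk].
exists (exist _ (Tagged (fun j => 'I_(lam j)) (Ordinal ltk)) lek : cell lam mu).
by rewrite /cell_pos /colidx /=; congr (_, _); apply: val_inj.
Qed.

Definition unboxed B : filling lam mu := [ffun c => B (cell_pos c)].

Lemma wt_unboxed B : (forall p, ~~ in_shape lam mu p -> B p = [::]) ->
  wt (unboxed B) = boxed_wt B.
Proof.
move=> B0; rewrite /boxed_wt (bigID (in_shape lam mu)) /=.
rewrite [X in _ = _ * X]big1 => [|p pout]; last by rewrite B0 // cell_wt0.
rewrite [RHS]mulr1.
rewrite (eq_bigl (mem [set cell_pos c | c in cell lam mu])) => [|p].
  rewrite big_imset /=; last by move=> c d _ _; apply: cell_pos_inj.
  by apply: eq_bigr => c _; rewrite /unboxed ffunE.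
apply/idP/imsetP => [/cell_posP[c <-]|[c _ ->]]; first by exists c.
exact: cell_pos_in.
Qed.

Lemma unboxed_tableau r s B : (forall p, ~~ in_shape lam mu p -> B p = [::]) ->
  is_tableau (unboxed B) && col_flagged r s (unboxed B) <->
  boxed_tableau lam mu r s B.
Proof.
move=> B0; split.
  move=> /andP[/and3P[/forallP mm /forallP row /forallP col] /forallP fl].
  split=> //.
  - by move=> p /cell_posP[c <-]; have := mm c; rewrite ffunE.
  - by move=> p /cell_posP[c <-]; have := fl c; rewrite ffunE => /andP[].
  - by move=> p /cell_posP[c <-]; have := fl c; rewrite ffunE => /andP[].
  - move=> p q pq1 pq2 /cell_posP[c cE] /cell_posP[d dE].
    have /forallP/(_ d)/implyP := row c; rewrite !ffunE cE dE; apply.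
    move: pq1 pq2; rewrite -cE -dE => /(congr1 val) /= E1 E2.
    by rewrite /Defs.row /Defs.col E1 E2 !eqxx.
  - move=> p q pq1 pq2 /cell_posP[c cE] /cell_posP[d dE].
    have /forallP/(_ d)/implyP := col c; rewrite !ffunE cE dE; apply.
    by move: pq1 pq2; rewrite -cE -dE /Defs.row /Defs.col /= => -> ->; rewrite !eqxx.
move=> bt; apply/andP; split; [apply/and3P; split|]; apply/forallP => c.
- by rewrite ffunE; apply: (bt_mm bt); apply: cell_pos_in.
- apply/forallP => d; apply/implyP => /andP[/eqP[rE] /eqP[cE]]; rewrite !ffunE.
  by apply: (bt_row bt); rewrite ?cell_pos_in //; apply: val_inj.
- apply/forallP => d; apply/implyP => /andP[/eqP[rE] /eqP[cE]]; rewrite !ffunE.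
  by apply: (bt_col bt); rewrite ?cell_pos_in //; apply: val_inj.
- by rewrite ffunE (bt_r bt (cell_pos_in c)) (bt_s bt (cell_pos_in c)).
Qed.

Lemma Gcol_boxed r s : Gcol lam mu r s = Gboxed N lam mu r s.
Proof.
apply/funext => m; rewrite /Gcol /Gboxed /infsum.
rewrite (reindex_fsbig unboxed [set B : boxed | boxed_tableau lam mu r s B]%classic).
  by apply: eq_fsbigr => B /set_mem bt; rewrite wt_unboxed //; apply: bt_out bt.
split.
- by move=> B bt; apply/unboxed_tableau => //; apply: bt_out bt.
- move=> B B' /set_mem bt /set_mem bt' /ffunP E; apply/ffunP => p.
  have [/cell_posP[c <-]|pout] := boolP (in_shape lam mu p).
    by have := E c; rewrite !ffunE.
  by rewrite (bt_out bt) // (bt_out bt').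
(* The preimage extends [T] by empty lists outside the shape. *)
- move=> T tT; pose B : boxed := [ffun p => oapp T [::] [pick c | cell_pos c == p]].
  have BE c : B (cell_pos c) = T c.
    rewrite ffunE; case: pickP => [d /eqP/cell_pos_inj -> //|/(_ c)].
    by rewrite eqxx.
  have TE : unboxed B = T by apply/ffunP => c; rewrite ffunE BE.
  exists B => //=; apply/unboxed_tableau; rewrite ?TE // => p pout.
  rewrite ffunE; case: pickP => // c /eqP cE.
  by rewrite -cE cell_pos_in in pout.
Qed.

End Cells.

Theorem theorem3p8 (n : nat) (lam mu r s : 'I_n -> nat)
  (n_gt0 : (0 < n)%N)
  (lam_part : is_partition lam) (mu_part : is_partition mu)
  (mu_sub_lam : forall i : 'I_n, (mu i <= lam i)%N)
  (r_gt0 : forall i : 'I_n, (0 < r i)%N)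
  (s_gt0 : forall i : 'I_n, (0 < s i)%N)
  (flags : forall i j : 'I_n, j = i.+1 :> nat -> (mu i < lam j)%N ->
     (r i)%:Z - (mu i)%:Z <= (r j)%:Z - (mu j)%:Z /\
     (s i)%:Z - (lam i)%:Z <= (s j)%:Z - (lam j)%:Z + 1) :
  Gcol lam mu r s =
    (\prod_(i < n) \prod_(r i <= l < (s i).+1) (1 - alpha_ i.+1 * x_ l)^-1)
    * \det (\matrix_(i < n, j < n)
        e_ominus ((lam i)%:Z - (mu j)%:Z - i%:Z + j%:Z)
          (X_ (r j) (s i)) (A_ i - A_ j.+1 - B_ (lam i) + B_ (mu j))).
Proof.
(* Any common bound on the parts of [lam] can serve as the height of the box; their sum is one. *)
have leN i : (lam i <= \sum_(k < n) lam k)%N by rewrite (bigD1 i) //= leq_addr.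
have homo f : is_partition f -> {homo f : i j / (i <= j)%N >-> (j <= i)%N}.
  by move=> /forallP fP i j leij; have /forallP/(_ j)/implyP := fP i; apply.
rewrite (Gcol_boxed mu leN); apply: Gboxed_jt => //.
split; try exact: homo; try exact: mu_sub_lam.
- by move=> i j jE lt; have [] := flags i j jE lt; lia.
- by move=> i j jE lt; have [] := flags i j jE lt; lia.
Qed.
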